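(* For all $n,m\ge0$, \[\sum_{\alpha} x^{\mathrm{futne}(\alpha)}y^{\mathrm{enhne}(\alpha)}=\sum_{\alpha} y^{\mathrm{futne}(\alpha)}x^{\mathrm{enhne}(\alpha)},\] where both sums range over all involutions $\alpha$ of $\{1,\dots,n\}$ with exactly $m$ fixed points; i.e. $\mathrm{futne}$ and $\mathrm{enhne}$ have a symmetric joint distribution on this set.
   Context: For an involution $\alpha$ of $\{1,\dots,n\}$, its diagram has an arc $(i,j)$ for each 2-cycle $(i\ j)$, $i<j$, and each fixed point $i$ is a loop $(i,i)$. An enhanced nesting is a set of distinct arcs/loops $(i_1,j_1),\dots,(i_\ell,j_\ell)$ with $i_1<\dots<i_\ell\le j_\ell<\dots<j_1$; its number of dots is $2\ell-1$ if $i_\ell=j_\ell$ and $2\ell$ otherwise. $\mathrm{enhne}(\alpha)$ is the maximal number of dots in an enhanced nesting of $\alpha$ (equivalently, the length of a longest decreasing subsequence of $\alpha$). The open matching of $\alpha$ is obtained by replacing each fixed point by an open arc (an arc with only a left endpoint). A nesting there is either closed arcs $i_1<\dots<i_\ell<j_\ell<\dots<j_1$ ($2\ell$ dots), or $\ell-1$ such closed arcs plus an open arc with left endpoint $a<i_1$ ($2\ell-1$ dots). $\mathrm{futne}(\alpha)$ is the maximal number of dots in a nesting of the open matching of $\alpha$. *)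

(* Defs.v *)
From mathcomp Require Import all_boot all_fingroup.

Set Implicit Arguments.
Unset Strict Implicit.
Unset Printing Implicit Defensive.

(* The ground set {1, ..., n} is 'I_n, i.e. shifted to {0, ..., n-1}.         *)

Definition involutions_with (n m : nat) : {set {perm 'I_n}} :=
  [set alpha : {perm 'I_n} | [forall i, alpha (alpha i) == i]
                           & #|[set i | alpha i == i]| == m].

Section Nestings.

Variables (n : nat) (alpha : {perm 'I_n}).

Definition is_loop (p : 'I_n * 'I_n) : bool := p.1 == p.2.

(* For an involution these are the 2-cycles (i j), i < j, as pairs (i, j),    *)
(* together with the loops (i, i) at the fixed points.                        *)
Definition diagram : {set 'I_n * 'I_n} :=
  [set p : 'I_n * 'I_n | (alpha p.1 == p.2) && (p.1 <= p.2)].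

Definition closed_arcs : {set 'I_n * 'I_n} :=
  [set p : 'I_n * 'I_n | (alpha p.1 == p.2) && (p.1 < p.2)].

(* An open arc is given by its left endpoint. *)
Definition open_arcs : {set 'I_n} := [set i | alpha i == i].

Definition encloses (p q : 'I_n * 'I_n) : bool := (p.1 < q.1) && (q.2 < p.2).

(* Nestings are listed from the outermost arc to the innermost one. The       *)
(* condition i_l <= j_l holds for every element of the diagram.               *)
Definition enhanced_nesting (s : seq ('I_n * 'I_n)) : bool :=
  all (mem diagram) s && sorted encloses s.

Definition enhanced_dots (s : seq ('I_n * 'I_n)) : nat :=
  if s is p :: s' then
    if is_loop (last p s') then (size s).*2.-1 else (size s).*2
  else 0.

(* The left endpoints in a nesting are distinct, so nestings have at most n   *)
(* elements and the bound on the length built into n.-bseq is harmless.       *)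
Definition enhne : nat :=
  \max_(s : n.-bseq ('I_n * 'I_n) | enhanced_nesting s) enhanced_dots s.

(* A nesting of the open matching: a nested sequence s of closed arcs, with   *)
(* optionally an open arc o starting to the left of all of them (s may then   *)
(* be empty).                                                                 *)
Definition open_nesting (o : option 'I_n) (s : seq ('I_n * 'I_n)) : bool :=
  [&& all (mem closed_arcs) s, sorted encloses s &
      if o is Some a then
        (a \in open_arcs) && (if s is p :: _ then a < p.1 else true)
      else true].

(* With an open arc and l - 1 closed arcs this is 2 l - 1 = 2 (l - 1) + 1.    *)
Definition open_dots (o : option 'I_n) (s : seq ('I_n * 'I_n)) : nat :=
  (size s).*2 + isSome o.

Definition futne : nat :=
  \max_(N : option 'I_n * n.-bseq ('I_n * 'I_n) | open_nesting N.1 N.2)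
    open_dots N.1 N.2.

End Nestings.

(* Main.v *)
Require Import Defs.
From Stdlib Require Import FunctionalExtensionality.
From mathcomp Require Import all_boot all_order all_algebra all_fingroup.
From mathcomp Require Import mpoly.
From mathcomp Require Import zify.

(* If q is the largest number of closed arcs in a nesting of alpha, both futne
   alpha and enhne alpha lie in {2q, 2q+1}.  Hence the symmetry follows as soon
   as, for every k, as many involutions with m fixed points satisfy
   enhne <= 2k as satisfy futne <= 2k.

   Reading the positions of alpha from right to left, insert the left end of an
   arc by row insertion at its closer and delete it at its opener: the nesting
   numbers become the lengths of first rows.  Since row insertion is a bijection
   (tableau, entry) -> (tableau, corner), both families are counted by walks on
   partitions with first row at most k.  For enhne these are the closed walks at
   the empty shape with m additional stationary steps D, allowed only when the
   first row is less than k; for futne they are the walks from a column of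
   height m to the empty shape without stationary steps.  Let A be the operator
   adding or removing a box and V_m the operator removing a vertical strip of
   size m, both restricted to first row at most k.  Then
   A V_m = V_m A + V_(m-1) D, which transforms one count into the other. *)

Set Implicit Arguments.
Unset Strict Implicit.
Unset Printing Implicit Defensive.

(** * Partitions as functions of row lengths *)

Section Shapes.

Implicit Types l g : nat -> nat.

Definition addbox l r : nat -> nat := fun x => l x + (x == r).
Definition subbox l r : nat -> nat := fun x => l x - (x == r).
Definition addable l r := (r == 0) || (l r < l r.-1).
Definition removable l s := l s.+1 < l s.
(** [i] bounds the number of rows, not of boxes; a step of a chain raises it by at most one. *)
Definition is_shape i l :=
  (forall x, l x.+1 <= l x) /\ (forall x, i <= x -> l x = 0).

Lemma addableE l r : addable l r = if r is r'.+1 then l r < l r' else true.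
Proof. by case: r. Qed.

Lemma addable_leq i l r : is_shape i l -> addable l r -> r <= i.
Proof.
case=> _ l0; case: r => // r; rewrite addableE => lr.
by case: (ltnP r i) => // /l0 r0; rewrite r0 in lr.
Qed.

Lemma removable_lt i l s : is_shape i l -> removable l s -> s < i.
Proof. by case=> _ l0; rewrite /removable => ls; case: (ltnP s i) => // /l0 s0; rewrite s0 in ls. Qed.

Lemma is_shape_add i l r : is_shape i l -> addable l r -> is_shape i.+1 (addbox l r).
Proof.
move=> lP la; have ri := addable_leq lP la; case: lP => lD l0.
split=> x; last by move=> ix; rewrite /addbox l0; lia.
have := lD x; move: la; rewrite /addbox addableE.
by case: r ri => [|r] ri; [lia | case: (x =P r) => [->|]; lia].
Qed.

Lemma is_shape_sub i l s : is_shape i l -> removable l s -> is_shape i (subbox l s).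
Proof.
case=> lD l0 ls; split=> x; last by move=> /l0 xi; rewrite /subbox xi.
have := lD x; move: ls; rewrite /subbox /removable.
by case: (x =P s) => [->|]; lia.
Qed.

Lemma is_shapeW i j l : i <= j -> is_shape i l -> is_shape j l.
Proof. by move=> ij [lD l0]; split=> // x jx; apply: l0; lia. Qed.

Lemma addboxK l r : subbox (addbox l r) r = l.
Proof.
by apply: functional_extensionality => x; rewrite /addbox /subbox addnK.
Qed.

Lemma subboxK l s : 0 < l s -> addbox (subbox l s) s = l.
Proof.
move=> ls; apply: functional_extensionality => x; rewrite /addbox /subbox.
by case: (x =P s) => [->|_]; lia.
Qed.

(** In different rows neither operation obstructs the other; the diagonal [r = s] is treated
    separately in [local_rule]. *)
Lemma addable_removable_swap i l r s : is_shape i l -> r != s ->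
  removable l s && addable (subbox l s) r = addable l r && removable (addbox l r) s.
Proof.
case=> lD _; rewrite /removable !addableE /subbox /addbox => rs.
have ls := lD s; have lSs := lD s.+1.
case: r rs => [|r] rs; first by lia.
have lr := lD r; have lSr := lD r.+1.
rewrite eqSS (eq_sym s r) (eq_sym s r.+1) (negPf rs).
by case: (eqVneq r s) => [<-|_] /=; apply/idP/idP; lia.
Qed.

(* Row insertion at one cell of a growth diagram: a horizontal step [a] meets a
   vertical step adding a box in row [b]. *)
Definition cell (a : option nat) (b : nat) : option nat * nat :=
  if a == Some b then (Some b.+1, b.+1) else (a, b).

(* The commutation relation [D U = U D + 1] for adding and removing a box, in the
   bijective form given by [cell]; the term [F (Some 0) 0] is the extra [1]. *)
Lemma local_rule K i l (F : option nat -> nat -> nat) : is_shape i l -> i < K ->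
  \sum_(s < K | removable l s)
     (F None s + \sum_(r < K | addable (subbox l s) r)
                   F (cell (Some (r : nat)) s).1 (cell (Some (r : nat)) s).2)
    + F (Some 0) 0
  = \sum_(s < K | removable l s) F None s
    + \sum_(r < K | addable l r) \sum_(s < K | removable (addbox l r) s) F (Some (r : nat)) s.
Proof.
move=> lP iK; rewrite big_split /= -addnA; congr (_ + _).
have lD := lP.1.
have -> : \sum_(s < K | removable l s) \sum_(r < K | addable (subbox l s) r)
              F (cell (Some (r : nat)) s).1 (cell (Some (r : nat)) s).2 =
   \sum_(s < K | removable l s)
     (F (Some s.+1) s.+1 + \sum_(r < K | addable (subbox l s) r && (r != s)) F (Some (r : nat)) s).
  apply: eq_bigr => s ls; rewrite (bigD1 s) /=; last first.
    by move: ls; rewrite addableE /removable /subbox; case: (s : nat) => // s'; have := lD s'; lia.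
  rewrite /cell eqxx; congr (_ + _); apply: eq_bigr => r /andP[_ rs].
  by rewrite ifF //; apply/eqP => -[] /val_inj rs'; rewrite rs' eqxx in rs.
have -> : \sum_(r < K | addable l r) \sum_(s < K | removable (addbox l r) s) F (Some (r : nat)) s =
   \sum_(r < K | addable l r)
     (F (Some (r : nat)) r + \sum_(s < K | removable (addbox l r) s && (s != r)) F (Some (r : nat)) s).
  apply: eq_bigr => r lr; rewrite (bigD1 r) //=.
  by rewrite /removable /addbox; have := lD r; lia.
rewrite !big_split /= addnAC; congr (_ + _).
  (* Diagonal terms: the addable rows are row 0 and the rows [s.+1] below a removable [s], so an
     index shift matches them, row 0 accounting for [F (Some 0) 0]. *)
  case: K iK => // K iK; rewrite [X in X + _]big_mkcond [RHS]big_mkcond big_ord_recr [RHS]big_ord_recl /=.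
  rewrite [X in _ + X + _]ifF; last by apply/negP => /(removable_lt lP); lia.
  rewrite addn0 addnC; congr (_ + _).
rewrite (exchange_big_dep predT) //= pair_big_dep /= [RHS]pair_big_dep /=.
apply: eq_bigl => -[r s] /=; have := addable_removable_swap (i := i) (l := l) (r := r) (s := s) lP.
case: (eqVneq r s) => [->|rs]; first by rewrite eqxx !andbF.
by rewrite !andbT; apply.
Qed.

End Shapes.

(** * Chains of shapes and row insertion *)

Section Chains.

Implicit Types (t : seq (option nat)) (l : nat -> nat).

Definition shape0 : nat -> nat := fun=> 0.

(* A chain of shapes growing by at most one box per step, most recent step
   first; [Some r] adds a box in row [r].  It encodes a partial standard
   tableau whose entries are the positions of the nontrivial steps. *)
Fixpoint shape_of t : nat -> nat :=
  if t is a :: t' then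
    if a is Some r then addbox (shape_of t') r else shape_of t'
  else shape0.

(* Positions are counted from the beginning of the chain, i.e. from the end of
   the list. *)
Fixpoint pending t x : bool :=
  if t is a :: t' then if x == size t' then isSome a else pending t' x
  else false.

(* Row insertion of the entry [j], together with the row of the new box. *)
Fixpoint insert t j : seq (option nat) * nat :=
  if t is a :: t' then
    if j == size t' then (Some 0 :: t', 0)
    else let u := insert t' j in ((cell a u.2).1 :: u.1, (cell a u.2).2)
  else ([::], 0).

Lemma size_insert t j : size (insert t j).1 = size t.
Proof. by elim: t => //= a t IH; case: eqP => //= _; rewrite IH. Qed.

Lemma isSome_cell a b : isSome (cell a b).1 = isSome a.
Proof. by rewrite /cell; case: eqP => // ->. Qed.

Lemma pending_insert t j x : j < size t ->
  pending (insert t j).1 x = (x == j) || pending t x.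
Proof.
elim: t => //= a t IH jt; case: eqP => [->|/eqP jt'] /=.
  by case: eqP.
rewrite size_insert isSome_cell; case: eqP => [->|_]; last by apply: IH; lia.
by rewrite eq_sym (negPf jt').
Qed.

Lemma shape_of_insert t j : j < size t -> ~~ pending t j ->
  shape_of (insert t j).1 = addbox (shape_of t) (insert t j).2.
Proof.
elim: t => //= a t IH jt; case: eqP => [_|/eqP jt'] /=; first by case: a.
move=> /(IH ltac:(lia)) {}IH; rewrite /cell; case: eqP => [->|_] /=.
  by rewrite IH.
case: a => [r|] //=; rewrite IH; apply: functional_extensionality => x.
by rewrite /addbox addnAC.
Qed.

Section Sum.

Variable K : nat.

(** Summation over chains as a recursion on functionals: this avoids a finite type of chains and
    lets [local_rule] act on the last step. *)
Fixpoint chain_sum i (F : seq (option nat) -> nat) : nat :=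
  if i is i'.+1 then
    chain_sum i' (fun t => F (None :: t) +
      \sum_(r < K | addable (shape_of t) r) F (Some (r : nat) :: t))
  else F [::].

Lemma chain_sumS i F : chain_sum i.+1 F =
  chain_sum i (fun t => F (None :: t) +
    \sum_(r < K | addable (shape_of t) r) F (Some (r : nat) :: t)).
Proof. by []. Qed.

Lemma eq_chain_sum i (F G : seq (option nat) -> nat) :
  (forall t, size t = i -> is_shape i (shape_of t) -> F t = G t) ->
  chain_sum i F = chain_sum i G.
Proof.
elim: i F G => [|i IH] F G FG /=; first exact: FG.
apply: IH => t ti tP; congr (_ + _).
  by apply: FG => /=; rewrite ?ti //; apply: is_shapeW tP.
apply: eq_bigr => r tr; apply: FG => /=; rewrite ?ti //.
exact: is_shape_add.
Qed.

Lemma chain_sumD i (F G : seq (option nat) -> nat) :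
  chain_sum i (fun t => F t + G t) = chain_sum i F + chain_sum i G.
Proof.
elim: i F G => [|i IH] F G //=; rewrite -IH; apply: eq_chain_sum => t _ _.
by rewrite big_split /= addnACA.
Qed.

Lemma chain_sum0 i : chain_sum i (fun=> 0) = 0.
Proof.
elim: i => //= i IH; rewrite -[RHS]IH; apply: eq_chain_sum => t _ _.
by rewrite big1.
Qed.

(* Row insertion is a bijection onto pairs (chain, removable row). *)
Lemma chain_sum_insert i (F : seq (option nat) -> nat -> nat) : i < K ->
  chain_sum i (fun t => \sum_(j < i | ~~ pending t j) F (insert t j).1 (insert t j).2)
  = chain_sum i (fun t => \sum_(s < K | removable (shape_of t) s) F t s).
Proof.
elim: i F => [|i IH] F iK.
  by rewrite /= big_ord0 big1 // => s; rewrite /removable.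
have insE t (a : option nat) : size t = i -> \sum_(j < i.+1 | ~~ pending (a :: t) j) F (insert (a :: t) j).1 (insert (a :: t) j).2 =
   \sum_(j < i | ~~ pending t j)
     F ((cell a (insert t j).2).1 :: (insert t j).1) (cell a (insert t j).2).2
   + (if a is None then F (Some 0 :: t) 0 else 0).
  move=> ti; rewrite big_mkcond big_ord_recr /= ti eqxx /=; congr (_ + _).
    rewrite [RHS]big_mkcond /=; apply: eq_bigr => j _.
    by rewrite (ltn_eqF (ltn_ord j)).
  by case: a.
(* [H t s] sums over the last step on the insertion side, in terms of the chain [t] and the row [s]
   produced by inserting into the shorter chain; [subbox] recovers the shape before that
   insertion. *)
pose H t s := F (None :: t) s +
  \sum_(r < K | addable (subbox (shape_of t) s) r)
     F ((cell (Some (r : nat)) s).1 :: t) (cell (Some (r : nat)) s).2.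
rewrite !chain_sumS; transitivity (chain_sum i (fun t =>
    \sum_(j < i | ~~ pending t j) H (insert t j).1 (insert t j).2 + F (Some 0 :: t) 0)).
  apply: eq_chain_sum => t ti tP; rewrite insE //.
  under [in X in _ + X]eq_bigr => r _ do rewrite insE // addn0.
  rewrite addnAC; congr (_ + _); rewrite (exchange_big_dep (fun j : 'I_i => ~~ pending t j)) //=.
  rewrite -big_split /=; apply: eq_bigr => j jt; rewrite /H; congr (_ + _).
  by apply: eq_bigl => r; rewrite jt andbT shape_of_insert ?ti // addboxK.
rewrite chain_sumD (IH H (ltnW iK)) -chain_sumD.
apply: eq_chain_sum => t ti tP.
exact: (local_rule (fun a s => F (a :: t) s) tP (ltnW iK)).
Qed.

End Sum.

End Chains.

(** * Weighted walks on bounded partitions *)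

Section Walks.

Variables K k : nat.

Implicit Types (t : seq (option nat)) (l : nat -> nat) (g h : (nat -> nat) -> nat).

(* Number of ways of processing the positions [i - 1], ..., [0], starting from
   the chain [t] and keeping [m] positions fixed: a pending position is an
   opener, any other one is either closer of a pending position to be inserted,
   or fixed; all first rows have length at most [k], and less than [k] at the
   fixed positions. *)
Fixpoint completions (i m : nat) t : nat :=
  if shape_of t 0 <= k then
    match i, t with
    | 0, _ => (m == 0 : nat)
    | i'.+1, Some _ :: t' => completions i' m t'
    | i'.+1, None :: t' =>
        \sum_(j < i' | ~~ pending t' j) completions i' m (insert t' j).1
        + (if m is m'.+1 then if shape_of t' 0 < k then completions i' m' t' else 0
           else 0)
    | _, [::] => 0
    end
  else 0.

Definition trunc g l := if l 0 <= k then g l else 0.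
Definition walk_up g l := \sum_(r < K | addable l r) trunc g (addbox l r).
Definition walk_down g l := \sum_(s < K | removable l s) trunc g (subbox l s).
Definition walk g l := walk_up g l + walk_down g l.
Definition stay g l := if l 0 < k then g l else 0.

(** Walks start at the empty shape and are weighted by [g] at their end; they traverse the process
    of [completions] backwards. *)
Fixpoint walk_sum (n m : nat) g : nat :=
  if n is n'.+1 then
    walk_sum n' m (walk g) + (if m is m'.+1 then walk_sum n' m' (stay g) else 0)
  else if m == 0 then g shape0 else 0.

(** One position at a time is absorbed into the weight: openers give [walk_up], fixed positions give
    [stay], and closers give [walk_down] once [chain_sum_insert] has replaced inserted entries by
    removable rows. *)
Lemma chain_sum_completions n m g : n <= K ->
  chain_sum K n (fun t => g (shape_of t) * completions n m t) = walk_sum n m g.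
Proof.
elim: n m g => [|n IH] m g nK.
  by rewrite /= /shape0; case: m => [|m] /=; rewrite ?muln1 ?muln0.
rewrite chain_sumS /= -IH; last by lia.
pose C m' := if m' is m''.+1 then chain_sum K n (fun t => stay g (shape_of t) * completions n m'' t) else 0.
transitivity (chain_sum K n (fun t => walk g (shape_of t) * completions n m t) + C m); last first.
  by congr (_ + _); rewrite /C; case: m => // m; rewrite IH //; lia.
pose F t s := trunc g (subbox (shape_of t) s) * completions n m t.
transitivity (chain_sum K n (fun t => \sum_(j < n | ~~ pending t j) F (insert t j).1 (insert t j).2)
  + chain_sum K n (fun t => walk_up g (shape_of t) * completions n m t) + C m); last first.
  rewrite chain_sum_insert //; congr (_ + _); rewrite -chain_sumD.
  apply: eq_chain_sum => t ti tP; rewrite /F /walk mulnDl [RHS]addnC; congr (_ + _).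
  by rewrite /walk_down big_distrl.
transitivity (chain_sum K n (fun t => \sum_(j < n | ~~ pending t j) F (insert t j).1 (insert t j).2)
  + chain_sum K n (fun t => walk_up g (shape_of t) * completions n m t)
  + chain_sum K n (fun t => if m is m'.+1 then stay g (shape_of t) * completions n m' t else 0)).
  rewrite -!chain_sumD; apply: eq_chain_sum => t ti tP.
  rewrite -addnA [X in _ = _ + X]addnC addnA; congr (_ + _); last first.
    rewrite /walk_up big_distrl /=; apply: eq_bigr => r tr; rewrite /trunc.
    by case: ifP; rewrite ?muln0.
  have -> : \sum_(j < n | ~~ pending t j) F (insert t j).1 (insert t j).2 =
     trunc g (shape_of t) * \sum_(j < n | ~~ pending t j) completions n m (insert t j).1.
    rewrite big_distrr; apply: eq_bigr => j jt.
    by rewrite /F shape_of_insert ?ti // addboxK.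
  rewrite /trunc /stay; case: (leqP (shape_of t 0) k) => tk; last first.
    by rewrite muln0 mul0n; case: (m) => // m'; rewrite ltnNge ltnW.
  rewrite mulnDr; congr (_ + _); case: (m) => [|m']; first by rewrite muln0.
  by case: ifP; rewrite ?muln0 ?mul0n.
congr (_ + _); rewrite /C; case: (m) => //.
exact: chain_sum0.
Qed.

Lemma eq_walk_sum n m g h :
  (forall l, is_shape n l -> l 0 <= k -> g l = h l) -> walk_sum n m g = walk_sum n m h.
Proof.
elim: n m g h => [|n IH] m g h gh /=; first by rewrite gh.
congr (_ + _).
  apply: IH => l lP lk; rewrite /walk; congr (_ + _); apply: eq_bigr => r lr; rewrite /trunc;
    case: ifP => // rk; apply: gh => //; first exact: is_shape_add.
  by apply: is_shapeW (is_shape_sub lP lr).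
case: m => // m; apply: IH => l lP lk; rewrite /stay; case: ifP => // _.
by apply: gh => //; apply: is_shapeW lP.
Qed.

Lemma walk_sumD n m g h :
  walk_sum n m (fun l => g l + h l) = walk_sum n m g + walk_sum n m h.
Proof.
elim: n m g h => [|n IH] m g h /=; first by case: ifP.
rewrite addnACA; congr (_ + _).
  rewrite -IH; apply: eq_walk_sum => l _ _; rewrite /walk /walk_up /walk_down addnACA -!big_split /=.
  by congr (_ + _); apply: eq_bigr => r _; rewrite /trunc; case: ifP.
case: m => // m; rewrite -IH; apply: eq_walk_sum => l _ _.
by rewrite /stay; case: ifP.
Qed.

End Walks.

(** * Vertical strips *)

(** Both sides run over sets of size [m.+1] with a marked element; on the left the marked element is
    listed apart from the rest. *)
Lemma sum_set_notin (T : finType) m (F : {set T} -> T -> nat) :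
  \sum_(S : {set T} | #|S| == m) \sum_(r | r \notin S) F (r |: S) r
  = \sum_(S : {set T} | #|S| == m.+1) \sum_(r in S) F S r.
Proof.
rewrite !pair_big_dep /= [RHS](reindex_onto (fun p => (p.2 |: p.1, p.2)) (fun p => (p.1 :\ p.2, p.2))) /=.
  apply: eq_bigl => -[S r] /=; rewrite setU11 cardsU1.
  case rS: (r \in S) => /=.
    rewrite andbF xpair_eqE eqxx andbT; apply/esym/negbTE/nandP; right.
    by rewrite ?eqb_id ?andbT; apply/eqP => E; move: rS; rewrite -E !inE eqxx.
  by rewrite setU1K ?rS // eqxx !andbT.
by move=> [S r] /= /andP[_ rS]; rewrite setD1K.
Qed.

Section Strips.

Variables K k : nat.

Implicit Types (l : nat -> nat) (g : (nat -> nat) -> nat) (S : {set 'I_K}).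

Definition in_strip S x := if insub x is Some y then y \in S else false.
Definition substrip l S : nat -> nat := fun x => l x - in_strip S x.
(** [S] lists the rows losing a box; positivity rules out the truncated difference [0 - 1 = 0]. *)
Definition strip l S :=
  [forall x : 'I_K, (substrip l S x.+1 <= substrip l S x) && (in_strip S x ==> (0 < l x))].

(** The operator [V_m], acting on weights. *)
Definition strip_sum m g l := \sum_(S : {set 'I_K} | (#|S| == m) && strip l S) g (substrip l S).

Lemma in_strip_ord S (r : 'I_K) : in_strip S r = (r \in S).
Proof. by rewrite /in_strip valK. Qed.

Lemma in_strip_out S x : K <= x -> in_strip S x = false.
Proof. by move=> Kx; rewrite /in_strip insubF // ltnNge Kx. Qed.

Lemma in_strip0 x : in_strip set0 x = false.
Proof. by rewrite /in_strip; case: insubP => // y; rewrite inE. Qed.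

Lemma in_stripU1 S (r : 'I_K) x : in_strip (r |: S) x = (x == r) || in_strip S x.
Proof.
rewrite /in_strip; case: insubP => [y _ <-|xK]; first by rewrite in_setU1.
by case: eqP => // xr; rewrite xr ltn_ord in xK.
Qed.

Lemma stripP i l S : is_shape i l -> i <= K ->
  reflect ((forall x, substrip l S x.+1 <= substrip l S x) /\ (forall x, in_strip S x -> 0 < l x))
          (strip l S).
Proof.
move=> [lD l0] iK; apply: (iffP forallP) => [lS|[lS1 lS2] x]; last first.
  by rewrite lS1 /=; apply/implyP/lS2.
have out x : K <= x -> l x = 0 by move=> Kx; apply: l0; lia.
split=> x; case: (ltnP x K) => xK.
- by case/andP: (lS (Ordinal xK)).
- by rewrite /substrip (out x.+1) //; lia.
- by case/andP: (lS (Ordinal xK)) => _ /implyP.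
- by rewrite in_strip_out.
Qed.

Lemma strip_sum0 i g l : is_shape i l -> i <= K -> strip_sum 0 g l = g l.
Proof.
move=> lP iK; have E : substrip l set0 = l.
  by apply: functional_extensionality => x; rewrite /substrip in_strip0 subn0.
rewrite /strip_sum (big_pred1 set0) ?E // => S; rewrite cards_eq0 /=.
case: eqP => [->|//]; apply/(stripP _ lP iK); rewrite E; split; first exact: lP.1.
by move=> x; rewrite in_strip0.
Qed.

Lemma strip_sum_shape0 m g : strip_sum m g shape0 = if m == 0 then g shape0 else 0.
Proof.
have P0 : is_shape 0 shape0 by [].
case: m => [|m]; first exact: strip_sum0 P0 _.
rewrite /strip_sum big1 // => S /andP[/eqP mS /(stripP _ P0)[] // _ S0].
have /set0Pn[x] : S != set0 by rewrite -card_gt0 mS.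
by rewrite -in_strip_ord => /S0.
Qed.

(** Row [s] loses two boxes in total, so a partition at the end forces both intermediate shapes to
    be partitions. *)
Lemma strip_down_in i l S s : is_shape i l -> i <= K -> in_strip S s ->
  removable l s && strip (subbox l s) S = strip l S && removable (substrip l S) s.
Proof.
move=> lP iK sS; have lx := lP.1.
apply/andP/andP => [[ls]|[/(stripP _ lP iK)[lD l0] ls]].
  move=> /(stripP _ (is_shape_sub lP ls) iK)[lD l0].
  move: lD l0; rewrite /removable /substrip /subbox => lD l0; split; last first.
    by have := lD s; have := l0 s sS; rewrite eqxx sS gtn_eqF //; lia.
  apply/(stripP _ lP iK); rewrite /substrip; split=> x; last by move=> /l0; lia.
  have := lD x; have := l0 x; have := lx x.
  by case: (x =P s) => [?|_]; case: (x.+1 =P s) => [?|_]; subst; rewrite ?sS; lia.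
have ls' : removable l s.
  by move: ls; have := lD s; have := l0 s sS; rewrite /removable /substrip sS; lia.
split=> //; apply/(stripP _ (is_shape_sub lP ls') iK).
move: lD ls l0; rewrite /removable /substrip /subbox => lD ls l0; split=> x.
  have := lD x.
  by case: (x =P s) => [?|_]; case: (x.+1 =P s) => [?|_]; subst; lia.
move=> xS; have := l0 x xS; case: (x =P s) => [?|_]; last by lia.
by subst; move: ls; rewrite sS; lia.
Qed.

(** As the strip avoids row [r], a partition at the end again forces both intermediate shapes to be
    partitions. *)
Lemma strip_up_notin i l S r : is_shape i l -> i < K -> ~~ in_strip S r ->
  addable l r && strip (addbox l r) S = strip l S && addable (substrip l S) r.
Proof.
move=> lP iK rS; have lx := lP.1.
apply/andP/andP => [[lr]|[/(stripP _ lP (ltnW iK))[lD l0] lr]].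
  move=> /(stripP _ (is_shape_add lP lr) iK)[lD l0].
  move: lD l0 lr; rewrite !addableE /substrip /addbox => lD l0 lr; split; last first.
    case: r rS lD l0 lr => // r rS lD l0 lr.
    by have := lD r; rewrite eqxx (negPf rS) ltn_eqF //; lia.
  apply/(stripP _ lP (ltnW iK)); rewrite /substrip; split=> x.
    have := lD x; have := lx x.
    by case: (x =P r) => [?|_]; case: (x.+1 =P r) => [?|_]; subst; rewrite ?(negPf rS); lia.
  by move=> xS; have := l0 x xS; case: (x =P r) => [?|_]; [subst; rewrite xS in rS|lia].
have lr' : addable l r.
  move: lr lD; rewrite !addableE /substrip; case: r rS => // r rS lr lD.
  by move: lr; rewrite (negPf rS); case pr : (in_strip S r) => /=; have := lx r; lia.
split=> //; apply/(stripP _ (is_shape_add lP lr') iK).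
move: lD lr l0; rewrite !addableE /substrip /addbox => lD lr l0; split=> x; last first.
  by move=> /l0; lia.
have := lD x.
case: (x =P r) => [?|_]; case: (x.+1 =P r) => [?|_]; subst; rewrite ?(negPf rS); lia.
Qed.


Lemma substrip_add l S r : ~~ in_strip S r ->
  substrip (addbox l r) S = addbox (substrip l S) r.
Proof.
move=> rS; apply: functional_extensionality => x; rewrite /substrip /addbox.
by case: eqP => [->|]; rewrite ?(negPf rS); lia.
Qed.

Lemma substrip_sub l S s : substrip (subbox l s) S = subbox (substrip l S) s.
Proof. by apply: functional_extensionality => x; rewrite /substrip /subbox; lia. Qed.

Lemma substripU1 l S (r : 'I_K) : r \notin S ->
  substrip l (r |: S) = subbox (substrip l S) r.
Proof.
rewrite -in_strip_ord => rS; apply: functional_extensionality => x.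
rewrite /substrip /subbox in_stripU1.
by case: eqP => [->|]; rewrite ?(negPf rS); lia.
Qed.

Lemma substrip_addU1 l S (r : 'I_K) : r \notin S ->
  substrip (addbox l r) (r |: S) = substrip l S.
Proof. by move=> rS; rewrite substripU1 // substrip_add ?in_strip_ord // addboxK. Qed.

(** The box removed by the walk, in a row outside [S], joins the strip. This lemma and the next two
    reduce the terms where walk and strip interfere to one strip with a marked row. *)
Lemma stripU1_sub i l S (s : 'I_K) : is_shape i l -> i <= K -> s \notin S ->
  removable l s && strip (subbox l s) S = strip l (s |: S) && removable l s.
Proof.
move=> lP iK sS; rewrite andbC; case ls: (removable l s); rewrite ?andbF //= !andbT.
apply/(stripP _ (is_shape_sub lP ls) iK)/(stripP _ lP iK);
  rewrite substripU1 // substrip_sub; move=> -[lD l0]; split=> // x.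
  rewrite in_stripU1; have := l0 x; rewrite /subbox; case: eqP => [->|] /=; last by lia.
  by move: ls; rewrite /removable; lia.
move=> xS; have := l0 x; rewrite in_stripU1 xS orbT => /(_ isT).
rewrite /subbox; case: eqP => [xs|]; last by lia.
by move: xS sS; rewrite xs in_strip_ord => ->.
Qed.

(** The box taken from row [s] can be put back, hence [addable] on the right. *)
Lemma stripU1_removable i l S (s : 'I_K) : is_shape i l -> i <= K -> s \notin S ->
  strip l S && removable (substrip l S) s = strip l (s |: S) && addable (substrip l (s |: S)) s.
Proof.
move=> lP iK sS; have sS' : ~~ in_strip S s by rewrite in_strip_ord.
have lx := lP.1; rewrite substripU1 //.
apply/andP/andP => -[/(stripP _ lP iK)[lD l0] ls].
  have ss : is_shape K (substrip l S).
    by split=> // x Kx; rewrite /substrip lP.2 //; lia.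
  split.
    apply/(stripP _ lP iK); rewrite substripU1 //; split; first exact: (is_shape_sub ss ls).1.
    move=> x; rewrite in_stripU1; case: eqP => [->|_] /=; last exact: l0.
    by move: ls; rewrite /removable /substrip; lia.
  move: ls; rewrite addableE /removable /subbox; case: (s : nat) => // s' ls'.
  by have := lD s'; rewrite eqxx ltn_eqF //; lia.
have ls0 : 0 < substrip l S s.
  by have := l0 s; rewrite in_stripU1 eqxx /substrip (negPf sS') subn0; apply.
have E := subboxK ls0.
have ss : is_shape K (subbox (substrip l S) s).
  split; first by rewrite -substripU1.
  by move=> x Kx; rewrite /subbox /substrip lP.2 //; lia.
split.
  apply/(stripP _ lP iK); split; first by rewrite -E; apply: (is_shape_add ss ls).1.
  by move=> x xS; apply: l0; rewrite in_stripU1 xS orbT.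
by rewrite -E /removable /addbox gtn_eqF // eqxx; have := ss.1 s; lia.
Qed.

(** The strip takes away the box just added, leaving what [S] leaves of [l]. *)
Lemma stripU1_addable i l S (r : 'I_K) : is_shape i l -> i < K -> r \notin S ->
  addable l r && strip (addbox l r) (r |: S) = strip l S && addable l r.
Proof.
move=> lP iK rS; rewrite andbC; case lr: (addable l r); rewrite ?andbF //= !andbT.
apply/(stripP _ (is_shape_add lP lr) iK)/(stripP _ lP (ltnW iK));
  rewrite substrip_addU1 //; move=> -[lD l0]; split=> // x.
  move=> xS; have := l0 x; rewrite in_stripU1 xS orbT => /(_ isT).
  rewrite /addbox; case: eqP => [xr|]; last by lia.
  by move: xS rS; rewrite xr in_strip_ord => ->.
by rewrite in_stripU1 /addbox; case: eqP => [->|_ /l0] /=; lia.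
Qed.

(* In both counting lemmas, the contributions of consecutive rows differ by a
   telescoping term. *)
Lemma count_strip_down i l S : is_shape i l -> i <= K -> strip l S ->
  \sum_(s in S) removable l s = \sum_(s in S) addable (substrip l S) s.
Proof.
move=> lP iK /(stripP _ lP iK)[lD l0].
have {}l0 x : in_strip S x <= l x by case: (in_strip S x) (l0 x) => // ->.
(* The defect [in_strip S N] between the partial sums telescopes and vanishes at [N = K]. *)
have H N : \sum_(s < N.+1) (in_strip S s && addable (substrip l S) s) =
    \sum_(s < N) (in_strip S s && removable l s) + in_strip S N.
  elim: N => [|N IH]; first by rewrite big_ord_recr !big_ord0 /= andbT.
  rewrite big_ord_recr IH [in RHS]big_ord_recr /= -!addnA; congr (_ + _).
  move: (lD N) (l0 N) (l0 N.+1) (lP.1 N); rewrite addableE /substrip /removable.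
  by case: (in_strip S N); case: (in_strip S N.+1) => /=; lia.
rewrite !(big_mkcond (fun s => s \in S)) /=.
transitivity (\sum_(s < K) (in_strip S s && removable l s)).
  by apply: eq_bigr => s _; rewrite in_strip_ord; case: ifP.
transitivity (\sum_(s < K) (in_strip S s && addable (substrip l S) s)); last first.
  by apply: eq_bigr => s _; rewrite in_strip_ord; case: ifP.
have := H K; rewrite big_ord_recr /= in_strip_out // !addn0 => <-.
by [].
Qed.

Lemma count_strip_up i l S : is_shape i l -> i < K -> l 0 <= k -> strip l S ->
  \sum_(r | r \notin S) (addable l r && (addbox l r 0 <= k)) =
  \sum_(r | r \notin S) removable (substrip l S) r + (substrip l S 0 < k).
Proof.
move=> lP iK lk /(stripP _ lP (ltnW iK))[lD l0].
have {}l0 x : in_strip S x <= l x by case: (in_strip S x) (l0 x) => // ->.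
(* The boundary term comes from row 0, whose length is capped by [k]; it is the source of the
   stationary steps. *)
have H N : \sum_(r < N.+1) (~~ in_strip S r && (addable l r && (addbox l r 0 <= k)))
     + in_strip S N
   = \sum_(r < N) (~~ in_strip S r && removable (substrip l S) r) + (substrip l S 0 < k).
  elim: N => [|N IH].
    rewrite big_ord_recr !big_ord0 /= /substrip /addbox; move: (l0 0).
    by case: (in_strip S 0) => /=; lia.
  rewrite big_ord_recr [in RHS]big_ord_recr /= [in RHS]addnAC -IH -!addnA; congr (_ + _).
  move: (lD N) (l0 N) (l0 N.+1) (lP.1 N); rewrite addableE /substrip /removable /addbox.
  by case: (in_strip S N); case: (in_strip S N.+1) => /=; lia.
rewrite !(big_mkcond (fun s => s \notin S)) /=.
transitivity (\sum_(r < K) (~~ in_strip S r && (addable l r && (addbox l r 0 <= k)))).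
  by apply: eq_bigr => s _; rewrite in_strip_ord; case: ifP.
transitivity (\sum_(r < K) (~~ in_strip S r && removable (substrip l S) r)
    + (substrip l S 0 < k)); last first.
  by congr (_ + _); apply: eq_bigr => s _; rewrite in_strip_ord; case: ifP.
have lK : l K = 0 by apply: lP.2; lia.
have := H K; rewrite big_ord_recr /= in_strip_out // addn0 => <-.
suff -> : addable l K = false by rewrite addn0.
by apply/negP => /(addable_leq lP); lia.
Qed.

End Strips.

(** * Intertwining strips with walks *)

Section StripWalk.

Variables K k : nat.

Implicit Types (l : nat -> nat) (g h : (nat -> nat) -> nat) (S : {set 'I_K}).

Lemma sum_if_const (I : finType) (P Q : pred I) (c : nat) :
  \sum_(i | P i) (if Q i then c else 0) = c * \sum_(i | P i) Q i.
Proof. by rewrite big_distrr; apply: eq_bigr => i _ /=; case: ifP; rewrite ?muln1 ?muln0. Qed.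

(** For [s] in [S] the terms agree one by one. For [s] outside [S] both sides become sums over
    strips of size [m.+1] of the same weight, with multiplicities that agree by
    [count_strip_down]. *)
Lemma walk_down_strip_sum i m g l : is_shape i l -> i < K -> l 0 <= k ->
  walk_down K k (strip_sum K m g) l = strip_sum K m (walk_down K k g) l.
Proof.
move=> lP iK lk.
transitivity (\sum_(S : {set 'I_K} | #|S| == m) \sum_(s < K)
    if removable l s && strip (subbox l s) S then g (subbox (substrip l S) s) else 0).
  rewrite exchange_big /walk_down big_mkcond /=; apply: eq_bigr => s _.
  case: (removable l s) => /=; last by rewrite big1.
  rewrite /trunc ifT; last by rewrite /subbox; lia.
  rewrite /strip_sum -big_mkcondr /=; apply: eq_bigr => S _.
  by rewrite substrip_sub.
transitivity (\sum_(S : {set 'I_K} | #|S| == m) \sum_(s < K)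
    if strip l S && removable (substrip l S) s then g (subbox (substrip l S) s) else 0); last first.
  rewrite /strip_sum big_mkcondr /=; apply: eq_bigr => S _.
  case: (strip l S) => /=; last by rewrite big1.
  rewrite /walk_down [RHS]big_mkcond; apply: eq_bigr => s _; case: ifP => // _.
  by rewrite /trunc ifT // /subbox /substrip; lia.
have splitS (F : {set 'I_K} -> 'I_K -> nat) : \sum_(S : {set 'I_K} | #|S| == m) \sum_(s < K) F S s
  = \sum_(S : {set 'I_K} | #|S| == m) \sum_(s in S) F S s + \sum_(S : {set 'I_K} | #|S| == m) \sum_(s | s \notin S) F S s.
  by rewrite -big_split; apply: eq_bigr => S _; rewrite (bigID (mem S)).
rewrite !splitS; congr (_ + _).
  by apply: eq_bigr => S _; apply: eq_bigr => s sS; rewrite (strip_down_in lP) ?in_strip_ord // ltnW.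
pose F S s := if strip l S && removable l s then g (substrip l S) else 0.
pose H S s := if strip l S && addable (substrip l S) s then g (substrip l S) else 0.
transitivity (\sum_(S : {set 'I_K} | #|S| == m) \sum_(s | s \notin S) F (s |: S) s).
  apply: eq_bigr => S _; apply: eq_bigr => s sS.
  by rewrite (stripU1_sub lP) // 1?ltnW // /F substripU1.
transitivity (\sum_(S : {set 'I_K} | #|S| == m) \sum_(s | s \notin S) H (s |: S) s); last first.
  apply: eq_bigr => S _; apply: eq_bigr => s sS.
  by rewrite (stripU1_removable lP (ltnW iK) sS) /H substripU1.
rewrite (sum_set_notin m F) (sum_set_notin m H).
apply: eq_bigr => S _.
rewrite /F /H.
case: (boolP (strip l S)) => lS //=; rewrite sum_if_const [RHS]sum_if_const; congr (_ * _).
by rewrite (count_strip_down lP) // ltnW.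
Qed.

(** Rows outside the strip commute termwise. A row inside it leads on both sides to a strip of size
    [m] and a marked row; the multiplicities differ by the boundary term of [count_strip_up], which
    is [stay]. *)
Lemma walk_up_strip_sum i m g l : is_shape i l -> i < K -> l 0 <= k ->
  walk_up K k (strip_sum K m.+1 g) l =
  strip_sum K m.+1 (walk_up K k g) l + strip_sum K m (stay k g) l.
Proof.
move=> lP iK lk.
transitivity (\sum_(S : {set 'I_K} | #|S| == m.+1) \sum_(r < K)
    if (addable l r && (addbox l r 0 <= k)) && strip (addbox l r) S
    then g (substrip (addbox l r) S) else 0).
  rewrite exchange_big /walk_up big_mkcond /=; apply: eq_bigr => r _.
  case: (addable l r) => /=; last by rewrite big1.
  rewrite /trunc; case: ifP => _; last by rewrite big1.
  by rewrite /strip_sum -big_mkcondr.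
have -> : strip_sum K m.+1 (walk_up K k g) l = \sum_(S : {set 'I_K} | #|S| == m.+1) \sum_(r < K)
    if strip l S && (addable (substrip l S) r && (addbox (substrip l S) r 0 <= k))
    then g (addbox (substrip l S) r) else 0.
  rewrite /strip_sum big_mkcondr /=; apply: eq_bigr => S _.
  case: (strip l S) => /=; last by rewrite big1.
  by rewrite /walk_up big_mkcond; apply: eq_bigr => r _; rewrite /trunc; case: (addable _ _).
have splitS (F : {set 'I_K} -> 'I_K -> nat) : \sum_(S : {set 'I_K} | #|S| == m.+1) \sum_(s < K) F S s
  = \sum_(S : {set 'I_K} | #|S| == m.+1) \sum_(s | s \notin S) F S s + \sum_(S : {set 'I_K} | #|S| == m.+1) \sum_(s in S) F S s.
  by rewrite -big_split; apply: eq_bigr => S _; rewrite (bigID (mem S)) /= addnC.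
rewrite !splitS -addnA; congr (_ + _).
  apply: eq_bigr => S _; apply: eq_bigr => r rS; have rS' : ~~ in_strip S r by rewrite in_strip_ord.
  rewrite substrip_add // andbAC (strip_up_notin lP) // -andbA.
  case lS: (strip l S); rewrite //= ; congr (if _ then _ else _); congr (_ && _).
  rewrite /addbox /substrip; case: (eqVneq 0 (r : nat)) => [r0|_]; last by lia.
  by rewrite r0 (negPf rS') subn0.
rewrite -!sum_set_notin /strip_sum [X in _ = _ + X]big_mkcondr -big_split /=; apply: eq_bigr => S _.
case: (boolP (strip l S)) => lS /=; last first.
  rewrite addn0 big1 => [|r rS]; last first.
    by rewrite andbAC (stripU1_addable lP) // (negPf lS).
  rewrite big1 // => r rS.
  by rewrite andbA -(stripU1_removable lP (ltnW iK) rS) (negPf lS).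
transitivity (g (substrip l S) * \sum_(r | r \notin S) (addable l r && (addbox l r 0 <= k))).
  rewrite -sum_if_const; apply: eq_bigr => r rS.
  by rewrite andbAC (stripU1_addable lP) // lS substrip_addU1.
rewrite (count_strip_up lP iK lk lS) mulnDr; congr (_ + _); last first.
  by rewrite /stay; case: ifP; rewrite ?muln1 ?muln0.
rewrite -sum_if_const; apply: eq_bigr => r rS.
rewrite andbA -(stripU1_removable lP (ltnW iK) rS) lS /=.
case rr: (removable _ _) => //=.
by rewrite substripU1 // subboxK ?ifT //; [rewrite /substrip; lia | move: rr; rewrite /removable; lia].
Qed.

(* The intertwining relation [A V_m = V_m A + V_(m-1) D], iterated. *)
Lemma walk_sum_strip_sum n m g : n <= K ->
  walk_sum K k n 0 (strip_sum K m g) = walk_sum K k n m g.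
Proof.
elim: n m g => [|n IH] m g nK /=; first exact: strip_sum_shape0.
rewrite addn0.
transitivity (walk_sum K k n 0 (fun l => strip_sum K m (walk K k g) l +
   if m is m'.+1 then strip_sum K m' (stay k g) l else 0)).
  apply: eq_walk_sum => l lP lk; rewrite /walk (walk_down_strip_sum _ _ lP nK lk).
  have -> : strip_sum K m (fun l => walk_up K k g l + walk_down K k g l) l =
     strip_sum K m (walk_up K k g) l + strip_sum K m (walk_down K k g) l.
    by rewrite /strip_sum -big_split.
  rewrite addnAC; congr (_ + _).
  case: m => [|m]; last exact: (walk_up_strip_sum m g lP nK lk).
  rewrite addn0 (strip_sum0 _ lP) ?(ltnW nK) //.
  apply: eq_bigr => r lr; rewrite /trunc; case: ifP => // _.
  by rewrite (strip_sum0 _ (is_shape_add lP lr)).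
rewrite walk_sumD IH ?(ltnW nK) //; congr (_ + _).
case: m => [|m]; last by rewrite IH // ltnW.
(* For [m = 0] the extra weight is zero, and so is its sum over walks. *)
elim: (n) => //= n' IHn; rewrite addn0 -[RHS]IHn; apply: eq_walk_sum => l _ _.
by rewrite /walk /walk_up /walk_down !big1 // => r _; rewrite /trunc; case: ifP.
Qed.

End StripWalk.

(** * Completions as a count of involutions *)

Section Runs.

Variables n k : nat.

Implicit Types (t : seq (option nat)) (alpha beta : {perm 'I_n}).

(** Extended by the identity beyond [n], so that [run] can recurse on plain positions. *)
Definition nat_perm alpha x := if insub x is Some y then alpha y : nat else x.

Lemma nat_permE alpha (x : 'I_n) : nat_perm alpha x = alpha x.
Proof. by rewrite /nat_perm valK. Qed.

(** The single branch of [completions] prescribed by [f]. *)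
Fixpoint run i t (f : nat -> nat) : bool :=
  (shape_of t 0 <= k) &&
  match i, t with
  | 0, _ => true
  | i'.+1, Some _ :: t' => run i' t' f
  | i'.+1, None :: t' =>
      if f i' == i' then (shape_of t' 0 < k) && run i' t' f
      else run i' (insert t' (f i')).1 f
  | _, [::] => false
  end.

Lemma eq_run i t (f f' : nat -> nat) : size t = i ->
  (forall x, x < i -> ~~ pending t x -> f x = f' x) -> run i t f = run i t f'.
Proof.
elim: i t => [|i IH] [|a t] //= [ti] ff; congr (_ && _).
have fft : {in [pred x | (x < i) && ~~ pending t x], f =1 f'}.
  by move=> x /andP[xi xt]; apply: ff; rewrite ?ti ?ltn_eqF //; lia.
case: a ff => [r|] ff; first by apply: IH => // x xi xt; apply: fft; rewrite inE xi.
rewrite -(ff i) //=; last by rewrite ti eqxx.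
case: eqP => _; first by rewrite (IH t) // => x xi xt; apply: fft; rewrite inE xi.
case: (ltnP (f i) i) => fi.
  apply: IH => [|x xi]; first by rewrite size_insert.
  by rewrite pending_insert ?ti // => /norP[_ xt]; apply: fft; rewrite inE xi.
(* A value beyond the chain never meets the base step of [insert], so the pending positions do not
   change. *)
apply: IH => [|x xi xt]; first by rewrite size_insert.
apply: fft; rewrite inE xi /=; apply: contra xt.
have: size t <= f i by rewrite ti.
elim: t {ti ff} => //= a t IH ft.
rewrite (gtn_eqF ft) /= size_insert isSome_cell; case: eqP => // _; apply: IH; lia.
Qed.

(** What remains to be chosen at stage [i] is a partial involution; processed and pending positions
    are made fixed points to get a permutation of all of ['I_n]. Only the other fixed points are
    counted by [m]. *)
Definition run_set i t m : {set {perm 'I_n}} :=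
  [set alpha : {perm 'I_n} | [&& [forall x, alpha (alpha x) == x],
     [forall x : 'I_n, ((i <= x) || pending t x) ==> (alpha x == x)],
     #|[set x : 'I_n | [&& x < i, ~~ pending t x & alpha x == x]]| == m
   & run i t (nat_perm alpha)]].

(** Multiplication by the transposition deletes the arc from [y] to [x0]; both ends become fixed,
    [x0] as a processed and [y] as a pending position. *)
Lemma run_set_close i t m (x0 y : 'I_n) alpha : size t = i -> x0 = i :> nat -> y < i ->
  ~~ pending t y -> shape_of t 0 <= k ->
  ((tperm x0 y * alpha)%g \in run_set i (insert t y).1 m) =
  ((alpha \in run_set i.+1 (None :: t) m) && (alpha x0 == y)).
Proof.
move=> ti x0i yi ty tk; set beta := (_ * _)%g.
have betaE x : beta x = alpha (tperm x0 y x) by rewrite permM.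
have x0y : x0 != y by apply/eqP => E; move: yi; rewrite -E x0i ltnn.
suff H : alpha x0 = y -> alpha y = x0 ->
    (beta \in run_set i (insert t y).1 m) = (alpha \in run_set i.+1 (None :: t) m).
  apply/idP/andP => [bX|[aX /eqP ax0]].
    have [/forallP b1 /forallP b2] : [forall x, beta (beta x) == x] /\
      [forall x : 'I_n, ((i <= x) || pending (insert t y).1 x) ==> (beta x == x)].
      by move: bX; rewrite inE => /and4P[].
    have ay : alpha y = x0.
      by have := b2 x0; rewrite x0i leqnn betaE tpermL => /eqP.
    have ax0 : alpha x0 = y.
      by have := b2 y; rewrite pending_insert ?ti // eqxx orbT betaE tpermR => /eqP.
    by rewrite -H // ax0 eqxx.
  have ay : alpha y = x0.
    by move: aX; rewrite inE => /and4P[/forallP/(_ x0)/eqP]; rewrite ax0.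
  by rewrite H.
move=> ax0 ay.
have bx0 : beta x0 = x0 by rewrite betaE tpermL.
have bY : beta y = y by rewrite betaE tpermR.
have bN x : x != x0 -> x != y -> beta x = alpha x.
  by move=> xx0 xy; rewrite betaE tpermD // eq_sym.
have aN x : x != x0 -> x != y -> alpha x != x0 /\ alpha x != y.
  move=> xx0 xy; split; apply/eqP => E.
    by move/eqP: xy; apply; apply: (@perm_inj _ alpha); rewrite E ay.
  by move/eqP: xx0; apply; apply: (@perm_inj _ alpha); rewrite E ax0.
have xiF (x : 'I_n) : x != x0 -> (x == i :> nat) = false.
  by move=> xx0; apply: contraNF xx0 => /eqP xi; apply/eqP/val_inj; rewrite /= xi x0i.
rewrite !inE; congr [&& _, _, _ & _].
- apply: eq_forallb => x; case: (eqVneq x x0) => [->|xx0]; first by rewrite !bx0 ax0 ay !eqxx.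
  case: (eqVneq x y) => [->|xy]; first by rewrite !bY ay ax0 !eqxx.
  by have [? ?] := aN x xx0 xy; rewrite !(bN x) // bN.
- apply: eq_forallb => x /=; rewrite pending_insert ?ti //.
  case: (eqVneq x x0) => [->|xx0].
    by rewrite bx0 eqxx implybT x0i eqxx /= leqNgt ltnSn.
  case: (eqVneq x y) => [->|xy].
    by rewrite bY !eqxx implybT ltn_eqF // leqNgt (ltnW yi : y < i.+1) (negPf ty).
  rewrite bN //; have xi := xiF x xx0.
  rewrite xi ltn_neqAle (eq_sym i) xi /=.
  by case: eqP => // /val_inj E; rewrite E eqxx in xy.
- congr (_ == _); apply: eq_card => x; rewrite !inE /= pending_insert ?ti //.
  case: (eqVneq x x0) => [->|xx0].
    by rewrite x0i ltnn ax0 [y == _]eq_sym (negPf x0y) !andbF.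
  case: (eqVneq x y) => [->|xy].
    by rewrite eqxx ay (negPf x0y) !andbF.
  rewrite bN //; have xi := xiF x xx0.
  rewrite xi ltnS [x <= i]leq_eqVlt xi /=.
  by case: eqP => // /val_inj E; rewrite E eqxx in xy.
- rewrite /= tk /= -x0i nat_permE ax0 ifF; last first.
    by apply/eqP => /val_inj E; rewrite E eqxx in x0y.
  rewrite x0i; apply: eq_run => [|x xi]; first by rewrite size_insert.
  rewrite pending_insert ?ti // => /norP[xy _].
  have xn : x < n by rewrite (ltn_trans xi) // -x0i.
  rewrite -[x]/(val (Ordinal xn)) !nat_permE bN //.
  by apply/eqP => /(congr1 val) /= E; rewrite E x0i ltnn in xi.
Qed.

Lemma card_run_set i t m : size t = i -> i <= n -> #|run_set i t m| = completions k i m t.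
Proof.
elim: i t m => [|i IH] [|a t] m //= ti iN.
  have one : forall alpha, alpha \in run_set 0 [::] m -> alpha = 1%g.
    move=> alpha; rewrite inE => /and4P[_ /forallP H _ _]; apply/permP => x.
    by rewrite perm1; apply/eqP/(implyP (H x)).
  have S0 alpha : [set x : 'I_n | [&& x < 0, ~~ pending [::] x & alpha x == x]] = set0.
    by apply/setP => x; rewrite !inE.
  have E : run_set 0 [::] m = if m == 0 then [set 1%g] else set0.
    apply/setP => alpha; apply/idP/idP => [aX|].
      have a1 := one _ aX; move: aX; rewrite inE S0 cards0 => /and4P[_ _ /eqP <- _].
      by rewrite a1 inE.
    case: eqP => [->|_]; last by rewrite inE.
    rewrite !inE S0 cards0 => /eqP ->; apply/and4P; split=> //.
    - by apply/forallP => x; rewrite !perm1.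
    - by apply/forallP => x; rewrite perm1 eqxx implybT.
  by rewrite E; case: (m) => [|?]; rewrite ?cards1 ?cards0.
case: ifP => tk; last first.
  by apply/eqP; rewrite cards_eq0; apply/eqP/setP => alpha; rewrite !inE /= tk !andbF.
case: ti => ti.
pose x0 : 'I_n := Ordinal iN.
have x0N (x : 'I_n) : x != x0 -> (x == i :> nat) = false.
  by move=> xx0; apply: contraNF xx0 => /eqP xi; apply/eqP/val_inj.
have ltSN (x : 'I_n) : x != x0 -> (x < i.+1) = (x < i).
  by move=> /x0N E; rewrite ltnS leq_eqVlt E.
case: a tk => [r|] tk.
  rewrite -IH // 1?ltnW //; apply: eq_card => alpha; rewrite !inE; congr [&& _, _, _ & _].
  - apply: eq_forallb => x; rewrite /= ti; case: (eqVneq x x0) => [->|xx0].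
      by rewrite /= eqxx leqnn orbT.
    by rewrite x0N // leqNgt ltSN // -leqNgt.
  - congr (_ == _); apply: eq_card => x; rewrite !inE /= ti.
    case: (eqVneq x x0) => [->|xx0]; first by rewrite /= eqxx ltnn andbF.
    by rewrite x0N // ltSN.
  - by rewrite /= tk.
(* Split by the image of [x0]: the image [x0] gives the stationary term, a non-pending [y < i] gives
   an insertion through [run_set_close], and all other images are impossible. *)
rewrite -sum1_card (partition_big (fun alpha => alpha x0) predT) //= (bigD1 x0) //= addnC.
congr (_ + _); last first.
  have fixE alpha : alpha x0 = x0 ->
    [set x : 'I_n | [&& x < i.+1, ~~ pending (None :: t) x & alpha x == x]] =
    x0 |: [set x : 'I_n | [&& x < i, ~~ pending t x & alpha x == x]].
    move=> ax0; apply/setP => x; rewrite !inE /= ti; case: (eqVneq x x0) => [->|xx0].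
      by rewrite ax0 /= !eqxx ltnSn.
    by rewrite x0N // ltSN.
  have x0out alpha : x0 \notin [set x : 'I_n | [&& x < i, ~~ pending t x & alpha x == x]].
    by rewrite inE ltnn.
  case: m => [|m].
    rewrite big1 // => alpha /andP[]; rewrite inE => /and4P[_ _ + _] /eqP ax0.
    by rewrite (fixE _ ax0) cardsU1 x0out.
  case: ifP => tk'; last first.
    rewrite big1 // => alpha /andP[]; rewrite inE => /and4P[_ _ _ +] /eqP ax0.
    by rewrite /= -[i]/(val x0) nat_permE ax0 eqxx tk' andbF.
  rewrite -IH // 1?ltnW // -sum1_card; apply: eq_bigl => alpha.
  case: (eqVneq (alpha x0) x0) => [ax0|ax0]; rewrite ?andbT ?andbF.
    rewrite !inE; congr [&& _, _, _ & _].
    - apply: eq_forallb => x; rewrite /= ti; case: (eqVneq x x0) => [->|xx0].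
        by rewrite ax0 eqxx !implybT.
      by rewrite x0N // leqNgt ltSN // -leqNgt.
    - by rewrite fixE // cardsU1 x0out.
    - by rewrite /= -[i]/(val x0) nat_permE ax0 eqxx tk' tk.
  apply/esym/negbTE; apply: contra ax0; rewrite inE => /and4P[_ /forallP/(_ x0)].
  by rewrite /= leqnn.
rewrite (big_ord_widen_cond n (fun j => ~~ pending t j) (fun j => completions k i m (insert t j).1)) 1?ltnW //.
rewrite big_mkcond [RHS]big_mkcond /=; apply: eq_bigr => y _.
case: (eqVneq y x0) => [->|yx0] /=; first by rewrite ltnn andbF.
have emptyE : (forall alpha, alpha \in run_set i.+1 (None :: t) m -> alpha x0 = y -> False) ->
    \sum_(alpha in run_set i.+1 (None :: t) m | alpha x0 == y) 1 = 0.
  by move=> H; rewrite big1 // => alpha /andP[aX /eqP ay]; case: (H _ aX ay).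
have [yi|yi] := ltnP y i; last first.
  rewrite andbF; apply: emptyE => alpha; rewrite inE => /and4P[_ /forallP/(_ y)].
  rewrite ltn_neqAle yi eq_sym x0N //= => /eqP ay _ _ ax0.
  by move/eqP: yx0; apply; apply: (@perm_inj _ alpha); rewrite ay ax0.
case: (boolP (pending t y)) => ty /=.
  apply: emptyE => alpha; rewrite inE => /and4P[_ /forallP/(_ y)].
  rewrite /= ti x0N // ty orbT => /eqP ay _ _ ax0.
  by move/eqP: yx0; apply; apply: (@perm_inj _ alpha); rewrite ay ax0.
rewrite -IH ?size_insert // 1?ltnW // -(card_preimset _ (mulgI (tperm x0 y))) -sum1_card.
by apply: eq_bigl => alpha; rewrite [RHS]inE run_set_close.
Qed.

End Runs.

(** * Single-column shapes and chains *)

Section Columns.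

Variable K : nat.

Implicit Types (t : seq (option nat)) (l : nat -> nat) (p : pred nat).

Definition is_shape0 l : nat := [forall x : 'I_K, l x == 0].

(** A strip that leaves nothing must consist of all nonempty rows, and it leaves nothing exactly
    when each of them has length 1. *)
Lemma strip_sum_is_shape0 i m l : is_shape i l -> i < K ->
  strip_sum K m is_shape0 l = (l 0 <= 1) && (\sum_(x < K) l x == m).
Proof.
move=> lP iK; pose S0 := [set x : 'I_K | 0 < l x].
have decr x y : x <= y -> l y <= l x.
  by move=> xy; rewrite -(subnKC xy); elim: (y - x) => [|d IH]; rewrite ?addn0 // addnS (leq_trans (lP.1 _)).
have zero S (H : strip l S) : is_shape0 (substrip l S) = (S == S0) && (l 0 <= 1).
  have [lD l0] := stripP _ lP (ltnW iK) H; congr (nat_of_bool _).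
  apply/forallP/andP => [z|[/eqP SE l01] x].
    have lE (x : 'I_K) : l x = (x \in S).
      have := z x; have := l0 x; rewrite /substrip in_strip_ord.
      by case: (x \in S) => [/(_ isT)|_] /eqP; lia.
    have K0 : 0 < K by lia.
    split; last by have := lE (Ordinal K0); case: (_ \in S) => /= ->.
    by apply/eqP/setP => x; rewrite inE lE; case: (x \in S).
  have := decr 0 x isT; rewrite /substrip in_strip_ord SE inE.
  by case: (l x) => [|[|]] //; lia.
rewrite /strip_sum; case: leqP => l01 /=; last first.
  rewrite big1 // => S /andP[_ lS]; rewrite zero //.
  by rewrite [l 0 <= 1]leqNgt l01 andbF.
have l1 x : l x <= 1 by rewrite (leq_trans (decr 0 x isT)).
have inS0 x : in_strip S0 x = (0 < l x) :> bool.
  rewrite /in_strip; case: insubP => [y _ <-|]; first by rewrite inE.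
  by rewrite -leqNgt => Kx; rewrite lP.2 //; lia.
have sub0 x : substrip l S0 x = 0.
  by rewrite /substrip inS0; have := l1 x; case: (l x) => [|[|]].
have S0P : strip l S0.
  by apply/(stripP _ lP (ltnW iK)); split=> x; rewrite ?sub0 // inS0.
have cS0 : #|S0| = \sum_(x < K) l x.
  rewrite -sum1_card big_mkcond; apply: eq_bigr => x _; rewrite inE.
  by have := l1 x; case: (l x) => [|[|]].
case: eqP => [cm|cm].
  rewrite (bigD1 S0) ?cS0 ?cm ?eqxx ?S0P //= zero // eqxx l01 big1 // => S /andP[/andP[_ lS] SS0].
  by rewrite zero // (negPf SS0).
rewrite big1 // => S /andP[/eqP Sm lS]; rewrite zero //; case: eqP => // SE.
by case: cm; rewrite -cS0 -SE.
Qed.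

Lemma sum_shape_of t : (forall x, K <= x -> shape_of t x = 0) ->
  \sum_(x < K) shape_of t x = \sum_(x < size t) pending t x.
Proof.
elim: t => [|a t IH] H /=; first by rewrite big_ord0 big1.
rewrite big_ord_recr /= eqxx.
under [in RHS]eq_bigr => x _ do rewrite ltn_eqF //.
case: a H => [r|] /= H; last by rewrite addn0 IH.
have rK : r < K by case: ltnP => // Kr; have := H r Kr; rewrite /addbox eqxx; lia.
rewrite -IH => [|x Kx]; last by have := H x Kx; rewrite /addbox; lia.
rewrite big_split /=; congr (_ + _).
by rewrite (bigD1 (Ordinal rK)) //= eqxx big1 // => x; rewrite -val_eqE /= => /negPf ->.
Qed.

(** The one-column tableau whose entries are the positions satisfying [p]. It is the initial chain
    of both processes: [p] is empty for [enhne], and selects the open arcs, which do not nest among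
    themselves, for [futne]. *)
Fixpoint column p i : seq (option nat) :=
  if i is i'.+1 then
    (if p i' then Some (\sum_(x < i') p x) else None) :: column p i'
  else [::].

Lemma size_column p i : size (column p i) = i.
Proof. by elim: i => //= i ->. Qed.

Lemma shape_of_column p i : shape_of (column p i) = fun x => (x < \sum_(y < i) p y : nat).
Proof.
elim: i => [|i IH] /=; first by apply: functional_extensionality => x; rewrite big_ord0.
rewrite big_ord_recr /=; case: (p i); rewrite IH ?addn0 //.
by apply: functional_extensionality => x; rewrite /addbox addn1; move: (\sum_(y < i) p y) => c; lia.
Qed.

Definition agree p t i : bool := [forall x : 'I_i, pending t x == p x].

Lemma agree_cons p a t : agree p (a :: t) (size t).+1 = (isSome a == p (size t)) && agree p t (size t).
Proof.
apply/forallP/andP => [H|[/eqP H1 /forallP H2] x].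
  split; first by have := H ord_max; rewrite /= eqxx.
  by apply/forallP => x; have := H (widen_ord (leqnSn _) x); rewrite /= ltn_eqF.
case: (ltngtP x (size t)) => xt /=; last by rewrite xt eqxx H1.
- by rewrite ltn_eqF //; apply: (H2 (Ordinal xt)).
- by have := ltn_ord x; lia.
Qed.

(** With the first row at most 1, the only place for a new box is the bottom of the column, so [p]
    determines the chain. *)
Lemma chain_sum_column p i (F : seq (option nat) -> nat) : i <= K ->
  chain_sum K i (fun t => if (shape_of t 0 <= 1) && agree p t i then F t else 0) = F (column p i).
Proof.
elim: i F => [|i IH] F iK.
  by rewrite /= ifT //; apply/forallP => -[].
rewrite chain_sumS.
pose F' t := if p i then \sum_(r < K | addable (shape_of t) r && (addbox (shape_of t) r 0 <= 1)) F (Some (r : nat) :: t)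
  else F (None :: t).
transitivity (chain_sum K i (fun t => if (shape_of t 0 <= 1) && agree p t i then F' t else 0)).
  apply: eq_chain_sum => t ti tP; rewrite -{1}ti agree_cons ti /= /F'.
  have -> : \sum_(r < K | addable (shape_of t) r)
      (if (shape_of (Some (r : nat) :: t) 0 <= 1) && agree p (Some (r : nat) :: t) i.+1 then F (Some (r : nat) :: t) else 0) =
     if (shape_of t 0 <= 1) && agree p t i && p i then \sum_(r < K | addable (shape_of t) r && (addbox (shape_of t) r 0 <= 1)) F (Some (r : nat) :: t) else 0.
    rewrite big_mkcondr /=; case: ifP => H; last first.
      rewrite big1 // => r _; rewrite -{1}ti agree_cons ti /= ifF //.
      apply/negP => /and3P[r1 /eqP pi at']; move: H; rewrite -pi at' !andbT.
      by move: r1; rewrite /addbox; lia.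
    apply: eq_bigr => r _; rewrite -{1}ti agree_cons ti /=.
    by move: H => /andP[/andP[_ ->] ->]; rewrite !andbT.
  by case: (p i) => /=; rewrite ?andbF ?andbT /= ?addn0.
rewrite IH ?(ltnW iK) // /F' /=; case: ifP => // pi.
have cK : \sum_(x < i) p x < K.
  rewrite (leq_ltn_trans _ iK) // -[leqRHS]card_ord -sum1_card leq_sum // => x _.
  by case: (p x).
rewrite shape_of_column (big_pred1 (Ordinal cK)) // => r /=.
rewrite addableE /addbox -val_eqE /=.
case: (r : nat) => [|r'] /=; first by lia.
by case: (\sum_(x < i) p x) => [|c]; lia.
Qed.

End Columns.

(** * First rows and maximal nestings *)

(* Length of the first row of the shape reached after [j] steps. *)
Fixpoint first_row (t : seq (option nat)) j :=
  if t is a :: t' then first_row t' j + ((size t' < j) && (a == Some 0)) else 0.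

Lemma first_row_full t j : size t <= j -> first_row t j = shape_of t 0.
Proof.
elim: t => //= a t IH tj; rewrite IH ?tj //=; last by lia.
by case: a => [[|r]|]; rewrite /addbox /= ?addn0 ?addn1.
Qed.

Lemma leq_first_row t j j' : j <= j' -> first_row t j <= first_row t j'.
Proof. by move=> jj; elim: t => //= a t IH; case: (a == _); lia. Qed.

(** Schensted bumping seen on the first row: the entry [y] is added and the next larger entry, if
    any, is expelled, so the count of entries below [j] grows just up to that entry. The new box
    lies in row 0 when nothing is expelled. *)
Lemma first_row_insert t y : y < size t -> ~~ pending t y ->
  ((insert t y).2 == 0) = (first_row t (size t) == first_row t y) /\
  forall j, first_row (insert t y).1 j =
    if y < j then maxn (first_row t j) (first_row t y).+1 else first_row t j.
Proof.
elim: t => //= a t IH yt; case: eqP => [yt' | /eqP yt'] /=.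
  move=> Na; have -> : a = None by case: a Na.
  rewrite yt' !andbF !addn0; split=> [|j].
    by rewrite !first_row_full ?leqnn ?leqnSn // !eqxx.
  case: (ltnP (size t) j) => tj /=; last by rewrite addn0.
  by rewrite !first_row_full ?(ltnW tj) // addn0; lia.
move=> ty; have {yt}yt : y < size t by lia.
have {IH ty} [IH0 IH] := IH yt ty; rewrite size_insert.
have E1 : first_row t (size t).+1 = first_row t (size t) by rewrite !first_row_full.
have Ey : (size t < y) = false by lia.
have mono := leq_first_row t (ltnW yt).
rewrite ltnSn Ey /= addn0 E1; move: IH0; move: (insert t y) IH => u IH IH0.
split=> [|j].
  rewrite /cell; case: (a =P Some u.2) => [->|au] /=.
    by move: IH0; case: u.2 => [|b] //=; lia.
  by move: IH0 au; case: (u.2) => [|b]; case: a => [[|a]|] //=; lia.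
rewrite IH; case: (ltnP (size t) j) => tj /=; last by rewrite !addn0.
have -> : y < j by lia.
have Ej : first_row t j = first_row t (size t) by rewrite !first_row_full // ltnW.
rewrite /cell Ej; case: (a =P Some u.2) => [->|au] /=.
  by move: IH0; case: u.2 => [|b] //=; lia.
by move: IH0 au; case: (u.2) => [|b]; case: a => [[|a]|] //=; lia.
Qed.

Section Nested.

Variables (n k : nat) (e : bool) (alpha : {perm 'I_n}).
Hypothesis alphaK : forall x, alpha (alpha x) = x.

(* Right end of the arc starting at [x], when [x] is an opener.  For [e = false]
   the open arcs end to the right of [n], without nesting among themselves. *)
Definition reach (x : 'I_n) : nat :=
  if alpha x == x then if e then x : nat else n + x else alpha x.

Definition encl (x y : 'I_n) := (x < y) && (reach y < reach x).

Definition nested j i (s : seq 'I_n) :=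
  sorted encl s && all (fun x : 'I_n => (x < j) && (i <= reach x)) s.

Definition is_max_nested j i v :=
  (exists2 s, nested j i s & size s = v) /\ (forall s, nested j i s -> size s <= v).

(** The invariant of the process: the tableau holds the openers of the arcs crossing stage [i], and
    its first row, cut at any [j], measures their largest nesting. *)
Definition nesting_chain i t :=
  [/\ size t = i, forall j, j <= i -> is_max_nested j i (first_row t j)
    & forall x : 'I_n, x < i -> pending t x = (i <= reach x)].

Lemma encl_trans : transitive encl.
Proof. by move=> y x z /andP[xy yx] /andP[yz zy]; apply/andP; split; lia. Qed.

Lemma reach_inj (x y : 'I_n) : x < y -> reach x = y -> alpha x = y /\ alpha y = x.
Proof.
move=> xy; rewrite /reach; case: ifP => _ H; last first.
  by have <- : alpha x = y by apply: val_inj.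
by have := ltn_ord y; case: (e) H; lia.
Qed.

Lemma is_max_nested_step j (x0 : 'I_n) v : j <= x0 ->
  (forall y : 'I_n, y < x0 -> reach y != x0) ->
  is_max_nested j x0.+1 v -> is_max_nested j x0 v.
Proof.
move=> jx H; have E s : nested j x0 s = nested j x0.+1 s.
  rewrite /nested; congr (_ && _); apply: eq_all => x.
  case: (ltnP x j) => //= xj; rewrite leq_eqVlt eq_sym (negPf (H x _)) //; lia.
by case=> -[s sP sv] m; split; [exists s; rewrite ?E | move=> s'; rewrite E; apply: m].
Qed.

Lemma nesting_chain_behead (x0 : 'I_n) a t : nesting_chain x0.+1 (a :: t) ->
  (forall y : 'I_n, y < x0 -> reach y != x0) -> nesting_chain x0 t.
Proof.
move=> [[ti] tm tp] H; split=> // [j jx|x xx].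
  apply: is_max_nested_step => //; have := tm j (leqW jx).
  by rewrite /= ti ltnNge jx addn0.
have := tp x (leqW xx); rewrite /= ti ltn_eqF // => ->.
by rewrite [RHS]leq_eqVlt eq_sym (negPf (H x xx)).
Qed.

(** A nesting either avoids the new arc, or ends with it after a nesting of arcs starting before
    [y]; this is the maximum in [first_row_insert]. *)
Lemma nesting_chain_insert (x0 y : 'I_n) t : nesting_chain x0.+1 (None :: t) ->
  alpha x0 = y -> y < x0 -> ~~ pending t y -> nesting_chain x0 (insert t y).1.
Proof.
move=> [[ti] tm tp] ax0 yx0 ty.
have ay : alpha y = x0 by rewrite -ax0 alphaK.
have ry : reach y = x0.
  by rewrite /reach ay ifF //; apply/eqP => E; rewrite E ltnn in yx0.
have runiq (x : 'I_n) : x < x0 -> x != y -> reach x != x0.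
  move=> xx0 /eqP xy; apply/eqP => E; apply: xy.
  by have [+ _] := reach_inj xx0 E; rewrite -ay => /perm_inj.
have yt : y < size t by rewrite ti.
have [_ fr] := first_row_insert yt ty.
split; first by rewrite size_insert.
  move=> j jx.
  have tmj : is_max_nested j x0.+1 (first_row t j).
    by have := tm j (leqW jx); rewrite /= ti ltnNge jx addn0.
  have tmy : is_max_nested y x0.+1 (first_row t y).
    by have := tm y (leqW (ltnW yx0)); rewrite /= ti ltnNge (ltnW yx0) addn0.
  rewrite fr ?ti //; case: ltnP => [yj|jy]; last first.
    case: tmj => -[s sP sv] m.
    have E s' : nested j x0 s' = nested j x0.+1 s'.
      rewrite /nested; congr (_ && _); apply: eq_all => x.
      case: (ltnP x j) => //= xj; rewrite leq_eqVlt eq_sym (negPf (runiq x _ _)) //; first lia.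
      by apply/eqP => E; rewrite E in xj; lia.
    by split; [exists s; rewrite ?E | move=> s'; rewrite E; apply: m].
  case: tmj => -[s sP sv] mj; case: tmy => -[sy syP syv] my; split.
    case: (leqP (first_row t y).+1 (first_row t j)) => H.
      exists s => //; move: sP; rewrite /nested => /andP[-> /allP sa] /=.
      by apply/allP => x /sa; lia.
    exists (rcons sy y); last by rewrite size_rcons syv.
    move: syP; rewrite /nested all_rcons => /andP[ss /allP sa].
    rewrite yj ry leqnn /=; apply/andP; split; last by apply/allP => x /sa; lia.
    case: sy ss sa {syv} => //= z sy ss sa; rewrite rcons_path ss /encl ry.
    by have := sa _ (mem_last z sy).
  move=> s' /andP[ss sa]; rewrite leq_max.
  case: (boolP (y \in s')) => ys; last first.
    apply/orP; left; apply: mj; rewrite /nested ss /=; apply/allP => x xs.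
    have /andP[xj xr] := allP sa x xs; rewrite xj /= ltn_neqAle xr andbT eq_sym.
    by apply: runiq; [lia | apply: contraNneq ys => <-].
  (* The arc of [y] ends at [x0], the smallest right end allowed, hence is innermost. *)
  apply/orP; right; case/splitPr: ys ss sa => s1 s2.
  rewrite (sorted_pairwise encl_trans) pairwise_cat all_cat /=.
  move=> /and3P[/allrelP rel p1 /andP[p2 _]] /and3P[a1 _ a2].
  have -> : s2 = [::].
    case: s2 p2 a2 rel => //= z s2 /andP[/andP[_ yz] _] /andP[/andP[_ zr] _] _.
    by move: yz; rewrite ry; lia.
  rewrite cats1 size_rcons ltnS; apply: my; rewrite /nested (sorted_pairwise encl_trans) p1 /=.
  apply/allP => x xs; have /andP[xy rr] := rel x y xs (mem_head _ _).
  by rewrite xy; move: rr; rewrite ry.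
move=> x xx; rewrite pending_insert ?ti //.
case: (eqVneq x y) => [->|xy]; first by rewrite ry leqnn eqxx.
have -> : (x == y :> nat) = false by rewrite -[RHS](negPf xy).
have := tp x (leqW xx); rewrite /= ti ltn_eqF // => ->.
by rewrite [RHS]leq_eqVlt eq_sym (negPf (runiq x xx xy)).
Qed.

(** A loop inside [size s] arcs makes [2 * size s + 1] dots, so the bound by [2 * k] is strict on
    [size s]. *)
Definition loop_bound i := forall x : 'I_n, x < i -> alpha x = x ->
  forall s, nested x x s -> size s < k.

Definition row_bound i := forall j, j <= i -> forall s, nested j j s -> size s <= k.

(** By the invariant at [j = i], each test of [run] on a first row is a bound on the nestings of
    arcs crossing that stage. *)
Lemma run_nested i t : i <= n -> nesting_chain i t ->
  run k i t (nat_perm alpha) <-> row_bound i /\ (e -> loop_bound i).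
Proof.
elim: i t => [|i IH] t iN tP.
  have -> : t = [::] by case: tP => /size0nil.
  split=> // _; split=> [j|_ x] //; rewrite leqn0 => /eqP -> s /andP[_].
  by case: s => //= x s /andP[].
have := tP; case: t tP => [|a t] tP [] // [ti] tm tp.
pose x0 : 'I_n := Ordinal iN.
have rowS : row_bound i.+1 <-> row_bound i /\ shape_of (a :: t) 0 <= k.
  have := tm i.+1 (leqnn _); rewrite first_row_full /= ?ti // => -[[s sP <-] m].
  split=> [H|[H1 H2] j].
    by split=> [j ji|]; [apply: H; apply: leqW | apply: H sP].
  by rewrite leq_eqVlt => /predU1P[-> s' /m|]; [lia | apply: H1].
have loopS : alpha x0 <> x0 -> loop_bound i.+1 <-> loop_bound i.
  move=> ax0; split=> [H x xi|H x]; first by apply: H; apply: leqW.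
  rewrite ltnS leq_eqVlt => /orP[/eqP xi ax|]; last exact: H.
  by case: ax0; have -> : x0 = x by apply: val_inj.
rewrite /=; case: a tP tm tp rowS => [r|] tP tm tp rowS.
  have r0 : i < reach x0 by rewrite -(tp x0) //= ti eqxx.
  have H (y : 'I_n) : y < x0 -> reach y != x0.
    move=> yx; apply/eqP => E; have [_ ax0] := reach_inj yx E.
    move: r0; rewrite /reach ax0 ifF; first by move: yx => /=; lia.
    by apply/eqP => Eq; rewrite Eq ltnn in yx.
  have {}IH := IH t (ltnW iN) (nesting_chain_behead (tP : nesting_chain x0.+1 _) H).
  have loopS' : (e -> loop_bound i.+1) <-> (e -> loop_bound i).
    case: (eqVneq (alpha x0) x0) => [ax0|/eqP ax0].
      by move: r0; rewrite /reach ax0 eqxx; case: (e) => //=; rewrite ltnn.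
    by have := loopS ax0; tauto.
  rewrite rowS loopS' /=; split=> [/andP[H1 /IH]|[[H1 H2] H3]]; first by tauto.
  by rewrite H2; apply/IH.
have r0 : (i < reach x0) = false by rewrite -(tp x0) //= ti eqxx.
rewrite -[X in nat_perm alpha X]/(val x0) nat_permE.
case: (eqVneq (alpha x0) x0) => [ax0|ax0].
  (* For [e = false] a fixed point has reach at least [n] and would be pending. *)
  have eT : e.
    by move: r0; rewrite /reach ax0 eqxx; case: (e) => //=; lia.
  have H (y : 'I_n) : y < x0 -> reach y != x0.
    move=> yx; apply/eqP => E; have [_] := reach_inj yx E.
    by rewrite ax0 => E'; rewrite E' ltnn in yx.
  have tP' := nesting_chain_behead (tP : nesting_chain x0.+1 _) H.
  have {}IH := IH t (ltnW iN) tP'.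
  have [_ /(_ i (leqnn _)) [[s sP sv] m] _] := tP'.
  have loopS' : loop_bound i.+1 <-> loop_bound i /\ shape_of t 0 < k.
    rewrite -(@first_row_full t i) ?ti //; split=> [B|[B1 B2] x].
      by split=> [x xi|]; [apply: B; apply: leqW | rewrite -sv; apply: (B x0)].
    rewrite ltnS leq_eqVlt => /orP[/eqP xi ax s'|]; last exact: B1.
    by rewrite xi => /m; lia.
  rewrite ax0 eqxx rowS /=; split.
    by move=> /and3P[H1 H2 /IH [H3 H4]]; do !split => // _; apply/loopS'; split=> //; apply: H4.
  move=> [[H1 H2] /(_ eT)/loopS' [H3 H4]]; rewrite H2 H4; apply/IH; split=> //.
have -> : (alpha x0 == i :> nat) = false.
  by apply/eqP => E; move/eqP: ax0; apply; apply: val_inj.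
have rE : reach x0 = alpha x0 by rewrite /reach (negPf ax0).
have yx0 : alpha x0 < x0.
  have : alpha x0 != i :> nat by apply: contra ax0 => /eqP E; apply/eqP/val_inj.
  by rewrite /= ltn_neqAle => -> /=; rewrite leqNgt -rE r0.
have ty : ~~ pending t (alpha x0).
  have := tp (alpha x0) (leqW yx0); rewrite /= ti ltn_eqF // => ->.
  rewrite /reach alphaK ifF /= ?ltnn //.
  by apply/eqP => E; rewrite -E ltnn in yx0.
have {}IH := IH _ (ltnW iN) (nesting_chain_insert (tP : nesting_chain x0.+1 _) erefl yx0 ty).
have := loopS (elimN eqP ax0) => LS.
rewrite rowS; split=> [/andP[H1 /IH]|[[H1 H2] H3]]; first by tauto.
by rewrite H2; apply/IH; tauto.
Qed.

End Nested.

(** * Both families as walks *)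

Section Counts.

Variables n k m : nat.

Implicit Types (alpha : {perm 'I_n}).

Definition fixed_at alpha : pred nat := fun x => (x < n) && (nat_perm alpha x == x).

Lemma fixed_atE alpha (x : 'I_n) : fixed_at alpha x = (alpha x == x).
Proof. by rewrite /fixed_at ltn_ord nat_permE. Qed.

Lemma pending_column p i x : pending (column p i) x = (x < i) && p x.
Proof.
elim: i => //= i IH; rewrite size_column; case: (ltngtP x i) => [xi|xi|->].
- by rewrite IH xi leqW.
- by rewrite IH ltnNge (ltnW xi) /= ltnS leqNgt xi.
- by rewrite ltnSn /=; case: (p i).
Qed.

(** The weight [is_shape0] singles out the trivial chain among all chains, so that
    [chain_sum_completions] applies. *)
Lemma card_enhanced_run :
  #|[set alpha in involutions_with n m | run k n (column pred0 n) (nat_perm alpha)]|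
  = walk_sum n.+1 k n m (is_shape0 n.+1).
Proof.
rewrite -chain_sum_completions //.
transitivity (completions k n m (column pred0 n)).
  rewrite -(@card_run_set n) ?size_column //; apply: eq_card => alpha; rewrite !inE.
  have pF x : pending (column pred0 n) x = false by rewrite pending_column andbF.
  have -> : [forall x : 'I_n, ((n <= x) || pending (column pred0 n) x) ==> (alpha x == x)].
    by apply/forallP => x; rewrite pF leqNgt ltn_ord.
  rewrite -andbA /=; congr [&& _, _ == _ & _]; apply: eq_card => x.
  by rewrite !inE ltn_ord pF.
rewrite -(chain_sum_column _ _ (leqnSn n)); apply: eq_chain_sum => t tn tP.
rewrite -(strip_sum0 _ tP (leqnSn n)) (strip_sum_is_shape0 _ tP) //.
rewrite sum_shape_of => [|x nx]; last by apply: tP.2; lia.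
rewrite tn sum_nat_eq0; have -> : agree pred0 t n = [forall x : 'I_n, pending t x == 0 :> nat].
  by apply: eq_forallb => x; case: (pending t x).
by case: (_ && _); rewrite ?mul1n.
Qed.

(** The initial column varies with [alpha], so the sum over [alpha] is exchanged with the sum over
    chains; [V_m] applied to [is_shape0] is the indicator of a column of height [m]. *)
Lemma card_open_run :
  #|[set alpha in involutions_with n m |
      run k n (column (fixed_at alpha) n) (nat_perm alpha)]|
  = walk_sum n.+1 k n 0 (strip_sum n.+1 m (is_shape0 n.+1)).
Proof.
rewrite -chain_sum_completions //.
transitivity (\sum_(alpha in involutions_with n m)
    chain_sum n.+1 n (fun t => if (shape_of t 0 <= 1) && agree (fixed_at alpha) t n
       then run k n t (nat_perm alpha) : nat else 0)).
  rewrite -sum1_card big_mkcond [RHS]big_mkcond /=; apply: eq_bigr => alpha _.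
  by rewrite inE chain_sum_column //; case: (alpha \in _); case: run.
have -> (P : pred {perm 'I_n}) G : \sum_(alpha | P alpha) chain_sum n.+1 n (G alpha) =
    chain_sum n.+1 n (fun t => \sum_(alpha | P alpha) G alpha t).
  rewrite !unlock /=; elim: (index_enum _) => /= [|alpha s IH]; first by rewrite chain_sum0.
  by case: (P alpha); rewrite ?IH // chain_sumD.
apply: eq_chain_sum => t tn tP; rewrite (strip_sum_is_shape0 _ tP) //.
rewrite sum_shape_of => [|x nx]; last by apply: tP.2; lia.
rewrite tn; set c := (\sum_(x < n) _).
rewrite -(@card_run_set n) // -sum1_card big_distrr [RHS]big_mkcond /=; rewrite [LHS]big_mkcond /=; apply: eq_bigr => alpha _.
rewrite !inE; case: (shape_of t 0 <= 1); last by rewrite /=; do 2!case: ifP.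
rewrite /=; case: (boolP [forall x, alpha (alpha x) == x]) => //= aK.
(* Since [run_set] is taken with no fixed points of its own, the fixed points of [alpha] are exactly
   the pending positions. *)
case: (boolP (agree (fixed_at alpha) t n)) => [/forallP ag|nag]; last first.
  suff -> : [&& [forall x : 'I_n, ((n <= x) || pending t x) ==> (alpha x == x)],
      #|[set x : 'I_n | [&& x < n, ~~ pending t x & alpha x == x]]| == 0
    & run k n t (nat_perm alpha)] = false by case: ifP.
  apply/negP => /and3P[/forallP b1 b2 _]; case/negP: nag.
  apply/forallP => x; rewrite fixed_atE; case tx: (pending t x).
    by have := b1 x; rewrite tx orbT.
  have : x \notin [set x : 'I_n | [&& x < n, ~~ pending t x & alpha x == x]].
    by move: b2; rewrite cards_eq0 => /eqP ->; rewrite inE.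
  by rewrite inE ltn_ord tx /= => /negPf ->.
have agE (x : 'I_n) : pending t x = (alpha x == x) by rewrite (eqP (ag x)) fixed_atE.
have -> : c = #|[set i | alpha i == i]|.
  rewrite -sum1_card [RHS]big_mkcond; apply: eq_bigr => x _; rewrite inE agE.
  by case: eqP.
have -> : [forall x : 'I_n, ((n <= x) || pending t x) ==> (alpha x == x)].
  by apply/forallP => x; rewrite agE leqNgt ltn_ord implybb.
have -> : [set x : 'I_n | [&& x < n, ~~ pending t x & alpha x == x]] = set0.
  by apply/setP => x; rewrite !inE agE andNb andbF.
by rewrite cards0 eqxx /=; case: eqP => _; case: run.
Qed.

Lemma card_enhanced_run_open_run :
  #|[set alpha in involutions_with n m | run k n (column pred0 n) (nat_perm alpha)]|
  = #|[set alpha in involutions_with n m |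
        run k n (column (fixed_at alpha) n) (nat_perm alpha)]|.
Proof. by rewrite card_enhanced_run card_open_run walk_sum_strip_sum. Qed.

End Counts.

(** * From dots to bounds on nestings *)

Section Bounds.

Variables (n : nat) (alpha : {perm 'I_n}).
Hypothesis alphaK : forall x, alpha (alpha x) = x.

Implicit Types (s : seq ('I_n * 'I_n)) (r : seq 'I_n).

Lemma nesting_chain_enhanced : nesting_chain true alpha n (column pred0 n).
Proof.
have reachF (x : 'I_n) : (n <= reach true alpha x) = false.
  by apply/negbTE; rewrite -ltnNge /reach; case: ifP.
split=> [|j jn|x xn]; [exact: size_column| |by rewrite pending_column andbF reachF].
have -> : first_row (column pred0 n) j = 0.
  by elim: (n) => //= i ->; rewrite andbF.
split; first by exists [::].
by move=> [|x r] // /andP[_ /andP[]]; rewrite reachF andbF.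
Qed.

Lemma first_row_column p i j :
  first_row (column p i) j = (0 < \sum_(x < i) ((x < j) && p x) : nat).
Proof.
elim: i => [|i IH] /=; first by rewrite big_ord0.
rewrite big_ord_recr /= IH size_column; case: (ltnP i j) => ij /=; last by rewrite !addn0.
have -> : \sum_(x < i) ((x < j) && p x) = \sum_(x < i) p x.
  by apply: eq_bigr => x _; rewrite (ltn_trans (ltn_ord x) ij).
case: (p i); rewrite ?addn0 //=.
by case: (\sum_(x < i) p x) => [|c]; rewrite //= addn1.
Qed.

(** Only open arcs survive at stage [n], and no two of them nest, which a single column reflects. *)
Lemma nesting_chain_open : nesting_chain false alpha n (column (fixed_at alpha) n).
Proof.
have reachE (x : 'I_n) : (n <= reach false alpha x) = (alpha x == x).
  by rewrite /reach; case: ifP => _; rewrite ?leq_addr // leqNgt ltn_ord.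
split=> [|j jn|x xn]; first exact: size_column; last first.
  by rewrite pending_column xn fixed_atE reachE.
rewrite first_row_column; case: posnP => [/eqP S0|S0].
  split; first by exists [::].
  move=> [|x r] // /andP[_ /andP[/andP[xj] ]]; rewrite reachE => ax.
  move: S0; rewrite sum_nat_eq0 => /forallP/(_ x).
  by rewrite fixed_atE xj ax.
split.
  have /existsP[x /andP[xj ax]] : [exists x : 'I_n, (x < j) && fixed_at alpha x].
    apply: contraLR S0; rewrite negb_exists => /forallP H.
    by rewrite big1 // => x _; rewrite (negPf (H x)).
  by exists [:: x] => //; rewrite /nested /= xj reachE -fixed_atE ax.
move=> [|x [|y r]] // /andP[/= /andP[/andP[xy yx] _]] /and3P[/andP[_ xr] /andP[_ yr] _].
by move: xr yr yx; rewrite !reachE /reach => -> ->; lia.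
Qed.

Definition arc (x : 'I_n) := (x, alpha x).

Definition closed_nesting s := all (mem (closed_arcs alpha)) s && sorted (@encloses n) s.

Lemma encloses_trans : transitive (@encloses n).
Proof. by move=> y x z /andP[a b] /andP[c d]; apply/andP; split; lia. Qed.

Lemma closed_arcsE p : (p \in closed_arcs alpha) = (alpha p.1 == p.2) && (p.1 < p.2).
Proof. by rewrite inE. Qed.

Lemma diagramE p : (p \in diagram alpha) = (alpha p.1 == p.2) && (p.1 <= p.2).
Proof. by rewrite inE. Qed.

Lemma size_nesting s : sorted (@encloses n) s -> size s <= n.
Proof.
move=> ss; pose lt_ord := relpre (@nat_of_ord n) ltn.
have us : uniq (map fst s).
  apply: (@sorted_uniq _ lt_ord) => [y x z|x|]; [exact: ltn_trans|exact: ltnn|].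
  by rewrite sorted_map; apply: sub_sorted ss => p q /andP[].
rewrite -(size_map fst) -(card_uniqP us) -[leqRHS]card_ord; exact: max_card.
Qed.

Lemma enhne_leqP h :
  enhne alpha <= h <-> forall s, enhanced_nesting alpha s -> enhanced_dots s <= h.
Proof.
split=> [/bigmax_leqP H s sP|H]; last by apply/bigmax_leqP => s /H.
have sn : size s <= n by move: sP => /andP[_ /size_nesting].
exact: (H (Bseq sn)).
Qed.

Lemma futne_leqP h :
  futne alpha <= h <-> forall o s, open_nesting alpha o s -> open_dots o s <= h.
Proof.
split=> [/bigmax_leqP H o s sP|H]; last by apply/bigmax_leqP => -[o s] /= /H.
have sn : size s <= n by move: sP => /and3P[_ /size_nesting].
exact: (H (o, Bseq sn)).
Qed.

Lemma enhanced_dots_rcons s q :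
  enhanced_dots (rcons s q) = (size s).*2.+1 + ~~ is_loop q.
Proof.
case: s => [|p s] /=; first by case: is_loop.
by rewrite last_rcons size_rcons; case: is_loop; rewrite /= ?addn0 ?addn1.
Qed.

Lemma sorted_rconsE s q : sorted (@encloses n) (rcons s q) =
  sorted (@encloses n) s && all (fun p => encloses p q) s.
Proof.
rewrite !(sorted_pairwise encloses_trans) -cats1 pairwise_cat /= andbT andbC.
by rewrite allrel1r.
Qed.

Lemma closed_nesting_enhanced s : closed_nesting s ->
  enhanced_nesting alpha s /\ enhanced_dots s = (size s).*2.
Proof.
move=> /andP[/allP sc ss]; split.
  apply/andP; split=> //; apply/allP => p /sc /=.
  by rewrite closed_arcsE diagramE => /andP[-> /ltnW].
case/lastP: s sc {ss} => [|s q] sc //.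
have := sc q; rewrite mem_rcons mem_head => /(_ isT) /=; rewrite closed_arcsE => /andP[_ qq].
by rewrite enhanced_dots_rcons size_rcons /is_loop -val_eqE ltn_eqF // addn1.
Qed.

Lemma enhanced_nesting_rcons s x : closed_nesting s -> alpha x = x ->
  all (fun p : 'I_n * 'I_n => p.1 < x < p.2) s ->
  enhanced_nesting alpha (rcons s (x, x)) /\ enhanced_dots (rcons s (x, x)) = (size s).*2.+1.
Proof.
move=> sc ax sx; split; last by rewrite enhanced_dots_rcons /is_loop eqxx addn0.
have [/andP[sd ss] _] := closed_nesting_enhanced sc.
apply/andP; split; first by rewrite all_rcons sd /= diagramE /= ax eqxx leqnn.
by rewrite sorted_rconsE ss.
Qed.

(** A loop can enclose nothing, so it can only be innermost. *)
Lemma enhanced_nestingP s : enhanced_nesting alpha s ->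
  closed_nesting s \/
  exists s' x, [/\ s = rcons s' (x, x), alpha x = x, closed_nesting s'
                 & all (fun p : 'I_n * 'I_n => p.1 < x < p.2) s'].
Proof.
case/lastP: s => [|s [x y]]; first by left.
rewrite /enhanced_nesting all_rcons sorted_rconsE => /andP[/andP[]].
rewrite /= diagramE /= => /andP[/eqP axy xy] /allP sd /andP[ss /allP sx].
have sc : closed_nesting s.
  apply/andP; split=> //; apply/allP => p ps /=; rewrite closed_arcsE.
  have := sd p ps; have /andP[/= px yp] := sx p ps.
  by rewrite /= diagramE => /andP[-> _]; lia.
case: (eqVneq x y) => [exy|exy]; [right|left].
  by rewrite -exy in axy sx *; exists s, x; split=> //; apply/allP.
move: sc => /andP[sc _]; rewrite /closed_nesting all_rcons sc sorted_rconsE ss /= andbT.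
rewrite closed_arcsE /= axy eqxx ltn_neqAle xy /= andbT val_eqE exy /=.
exact/allP.
Qed.

Lemma closed_nesting_arc e r : sorted (encl e alpha) r -> all (fun x : 'I_n => x < alpha x) r ->
  closed_nesting (map arc r).
Proof.
move=> rs ra; apply/andP; split.
  apply/allP => _ /mapP[x /(allP ra) xa ->] /=.
  by rewrite closed_arcsE /= eqxx.
rewrite sorted_map; apply: sub_in_sorted ra rs => x y xa ya.
have reachE (z : 'I_n) : z < alpha z -> reach e alpha z = alpha z.
  by move=> za; rewrite /reach ifF // -val_eqE gtn_eqF.
by rewrite /encl !reachE.
Qed.

Lemma closed_nesting_nested e s : closed_nesting s ->
  sorted (encl e alpha) (map fst s) /\
  forall p, p \in s -> p.1 < p.2 /\ reach e alpha p.1 = p.2.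
Proof.
move=> /andP[/allP sc ss].
have sE p : p \in s -> p.1 < p.2 /\ reach e alpha p.1 = p.2.
  move=> /sc /=; rewrite closed_arcsE => /andP[/eqP a12 p12]; split=> //.
  by rewrite /reach a12 ifF // -val_eqE gtn_eqF.
split=> //; rewrite sorted_map.
have sa : all (mem s) s by apply/allP.
apply: sub_in_sorted sa ss => p q /sE[_ pE] /sE[_ qE] /andP[p1 p2].
by rewrite /= /encl pE qE p1 p2.
Qed.

(** All arcs of a nesting cross the right end of the innermost one; hence bounds at single stages
    control every nesting. *)
Lemma closed_nesting_last e s q : closed_nesting (rcons s q) ->
  nested e alpha q.2 q.2 (map fst (rcons s q)).
Proof.
move=> sc; have [ss sE] := closed_nesting_nested e sc; rewrite /nested ss /=.
apply/allP => _ /mapP[p ps ->]; have [p12 ->] := sE p ps.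
have [q12 _] : q.1 < q.2 /\ reach e alpha q.1 = q.2.
  by apply: sE; rewrite mem_rcons mem_head.
move: sc ps => /andP[_]; rewrite sorted_rconsE => /andP[_ /allP sq].
rewrite mem_rcons inE => /predU1P[->|/sq /andP[p1 p2]]; first by rewrite q12 leqnn.
by rewrite (ltn_trans p1 q12) (ltnW p2).
Qed.


(** Nestings with an even number of dots correspond to [row_bound], those with an innermost loop to
    [loop_bound]. *)
Lemma enhne_bounds k : enhne alpha <= k.*2 <->
  row_bound k true alpha n /\ loop_bound k true alpha n.
Proof.
have arcs j r : nested true alpha j j r ->
    closed_nesting (map arc r) /\ (forall x, x \in r -> x < j <= alpha x).
  move=> /andP[rs /allP ra].
  have rj x : x \in r -> x < j <= alpha x.
    by move=> /ra; rewrite /reach; case: eqP => [->|_]; lia.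
  by split=> //; apply: (closed_nesting_arc rs); apply/allP => x /rj; lia.
rewrite enhne_leqP; split=> [H|[H1 H2] s sP].
  split=> [j jn r /arcs[rP _]|x xn ax r /arcs[rP rx]].
    have [sP sd] := closed_nesting_enhanced rP.
    by have := H _ sP; rewrite sd size_map leq_double.
  have rx' : all (fun p : 'I_n * 'I_n => p.1 < x < p.2) (map arc r).
    apply/allP => _ /mapP[z zr ->] /=; have /andP[zx xz] := rx z zr.
    rewrite zx /= ltn_neqAle xz andbT; apply: contraTneq zx => /val_inj E.
    by rewrite -leqNgt -[z]alphaK -E ax.
  have [sP sd] := enhanced_nesting_rcons rP ax rx'.
  by have := H _ sP; rewrite sd size_map; lia.
case: (enhanced_nestingP sP) => [sc|[s' [x [-> ax sc sx]]]].
  have [_ ->] := closed_nesting_enhanced sc; rewrite leq_double.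
  case/lastP: s sc {sP} => [|s q] // sc.
  by have := H1 q.2 (ltnW (ltn_ord _)) _ (closed_nesting_last true sc); rewrite size_map.
have [_ ->] := enhanced_nesting_rcons sc ax sx; rewrite ltn_double.
have [ss sE] := closed_nesting_nested true sc.
rewrite -(size_map fst); apply: (H2 x (ltn_ord x) ax); rewrite /nested ss /=.
apply/allP => _ /mapP[p ps ->]; have [_ ->] := sE p ps.
by have /andP[-> /ltnW] := allP sx p ps.
Qed.

(** A nesting with [l] members has [2 l] or [2 l - 1] dots, and either is at most [2 k] exactly when
    [l <= k]. Open arcs reach beyond every closed one, so only the outermost member can be open. *)
Lemma futne_bounds k : futne alpha <= k.*2 <-> row_bound k false alpha n.
Proof.
rewrite futne_leqP; split=> [H j jn r|H o s /and3P[sc ss oP]].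
  move=> /andP[rs /allP ra].
  have closed (x : 'I_n) : alpha x != x -> x \in r -> x < alpha x.
    by move=> /negPf ax /ra; rewrite /reach ax; lia.
  case: r rs ra closed => [|a r] // rs ra closed.
  have rclosed x : x \in r -> x < alpha x.
    move=> xr; apply: closed; last by rewrite inE xr orbT.
    have := rs; rewrite (sorted_pairwise (@encl_trans _ _ _)) /= => /andP[/allP/(_ x xr) + _].
    rewrite /encl /reach => /andP[ax]; apply: contraTneq => ->; rewrite eqxx -leqNgt.
    by case: ifP => _; have := ltn_ord (alpha a); lia.
  have rP : closed_nesting (map arc r).
    by apply: (closed_nesting_arc (path_sorted rs)); apply/allP => x /rclosed.
  case: (eqVneq (alpha a) a) => aa.
    have := H (Some a) (map arc r); rewrite /open_dots size_map addn1 ltn_double; apply.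
    move: rP => /andP[r1 r2]; apply/and3P; split=> //; rewrite inE aa eqxx /=.
    by case: (r) rs => //= x r' /andP[/andP[]].
  have raP : closed_nesting (map arc (a :: r)).
    apply: (closed_nesting_arc rs); apply/allP => x; rewrite inE => /predU1P[->|/rclosed //].
    by apply: closed; rewrite // mem_head.
  have := H None (map arc (a :: r)); rewrite /open_dots size_map addn0 leq_double; apply.
  by move: raP => /andP[r1 r2]; apply/and3P.
have sP : closed_nesting s by apply/andP.
case: o oP => [a /andP[]|_]; last first.
  rewrite /open_dots addn0 leq_double; case/lastP: s sP {sc ss} => [|s q] // sP.
  by have := H q.2 (ltnW (ltn_ord _)) _ (closed_nesting_last false sP); rewrite size_map.
rewrite inE => /eqP aa sa; rewrite /open_dots addn1 ltn_double.
have ra : reach false alpha a = n + a by rewrite /reach aa eqxx.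
case/lastP: s sP {sc ss} sa => [|s q] sP sa.
  apply: (H n (leqnn _) [:: a]); rewrite /nested /= ra ltn_ord leq_addr //.
have := H q.2 (ltnW (ltn_ord _)) (a :: map fst (rcons s q)); rewrite /= size_map; apply.
have /andP[ss sq] := closed_nesting_last false sP.
have aq : a < q.1.
  have [/andP[_ sr] _] := conj sP isT.
  case: s sa sr {sP ss sq} => [|p s] //= ap.
  rewrite (path_sortedE encloses_trans) => /andP[/allP/(_ q) pq _].
  by have := pq; rewrite mem_rcons mem_head => /(_ isT)/andP[pq1 _]; apply: ltn_trans ap pq1.
have [_ /(_ q)] := closed_nesting_nested false sP; rewrite mem_rcons mem_head => /(_ isT) [q12 _].
rewrite /nested /= sq ra andbT; apply/andP; split; last by rewrite (ltn_trans aq q12) (leq_trans (ltnW (ltn_ord _)) (leq_addr _ _)).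
have [_ sE] := closed_nesting_nested false sP.
have ltn_reach (x : 'I_n) : x < n + a by rewrite (leq_trans (ltn_ord x)) ?leq_addr.
by case: s sa ss sE {sP sq} => [|p s] /= sa ss sE; have [_ E] := sE _ (mem_head _ _);
  rewrite /encl sa ra E ltn_reach ?ss.
Qed.

(** The odd bound leaves room for one loop, so only the closed arcs matter; likewise below for one
    open arc. *)
Lemma enhne_odd_bound k : enhne alpha <= k.*2.+1 <->
  forall s, closed_nesting s -> size s <= k.
Proof.
rewrite enhne_leqP; split=> H s sP.
  by have [/H + sd] := closed_nesting_enhanced sP; rewrite sd; lia.
case: (enhanced_nestingP sP) => [sc|[s' [x [-> ax sc sx]]]].
  by have [_ ->] := closed_nesting_enhanced sc; have := H s sc; lia.
by have [_ ->] := enhanced_nesting_rcons sc ax sx; have := H s' sc; lia.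
Qed.

Lemma futne_odd_bound k : futne alpha <= k.*2.+1 <->
  forall s, closed_nesting s -> size s <= k.
Proof.
rewrite futne_leqP; split=> [H s /andP[sc ss]|H o s /and3P[sc ss _]].
  have := H None s; rewrite /open_nesting sc ss /open_dots => /(_ isT) /=; lia.
have := H s; rewrite /closed_nesting sc ss /open_dots => /(_ isT).
by case: o => /=; lia.
Qed.

Lemma half_futne_enhne : (futne alpha)./2 = (enhne alpha)./2.
Proof.
have H k : (futne alpha <= k.*2.+1) = (enhne alpha <= k.*2.+1).
  by apply/idP/idP => [/futne_odd_bound/enhne_odd_bound|/enhne_odd_bound/futne_odd_bound].
have := H (futne alpha)./2; have := H (enhne alpha)./2.
by have := odd_double_half (futne alpha); have := odd_double_half (enhne alpha); lia.
Qed.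

Lemma run_enhne k : run k n (column pred0 n) (nat_perm alpha) = (enhne alpha <= k.*2).
Proof.
have R := run_nested k alphaK (leqnn n) nesting_chain_enhanced.
apply/idP/idP => [/R[H1 H2]|/enhne_bounds[H1 H2]]; last by apply/R.
by apply/enhne_bounds; split=> //; apply: H2.
Qed.

Lemma run_futne k :
  run k n (column (fixed_at alpha) n) (nat_perm alpha) = (futne alpha <= k.*2).
Proof.
have R := run_nested k alphaK (leqnn n) nesting_chain_open.
by apply/idP/idP => [/R[/futne_bounds]|/futne_bounds H] //; apply/R.
Qed.

End Bounds.

(** * Equidistribution and the generating function *)

Lemma card_enhne_futne_leq n m k :
  #|[set alpha in involutions_with n m | enhne alpha <= k.*2]| =
  #|[set alpha in involutions_with n m | futne alpha <= k.*2]|.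
Proof.
have := card_enhanced_run_open_run n k m.
have -> : [set alpha in involutions_with n m | run k n (column pred0 n) (nat_perm alpha)] =
    [set alpha in involutions_with n m | enhne alpha <= k.*2].
  apply/setP => alpha; rewrite !inE -!andbA; case: (boolP [forall x, _]) => //= /forallP aK.
  by rewrite run_enhne // => x; apply/eqP.
move=> ->; congr #|pred_of_set _|; apply/setP => alpha.
rewrite !inE -!andbA; case: (boolP [forall x, _]) => //= /forallP aK.
by rewrite run_futne // => x; apply/eqP.
Qed.

(** Values below [2 k] occur for the same involutions, because the halves agree; subtracting them
    from the previous count isolates the value [2 k]. *)
Lemma card_enhne_futne_even n m k :
  #|[set alpha in involutions_with n m | enhne alpha == k.*2]| =
  #|[set alpha in involutions_with n m | futne alpha == k.*2]|.
Proof.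
have split_leq (f : {perm 'I_n} -> nat) :
    #|[set alpha in involutions_with n m | f alpha <= k.*2]| =
    #|[set alpha in involutions_with n m | f alpha == k.*2]|
    + #|[set alpha in involutions_with n m | f alpha < k.*2]|.
  rewrite -cardsUI [X in _ = _ + X](_ : _ = 0) ?addn0; last first.
    apply/eqP; rewrite cards_eq0; apply/eqP/setP => alpha; rewrite !inE.
    by case: ltngtP; rewrite ?andbF.
  by apply: eq_card => alpha; rewrite !inE -andb_orr -leq_eqVlt.
have lt_eq : #|[set alpha in involutions_with n m | enhne alpha < k.*2]| =
    #|[set alpha in involutions_with n m | futne alpha < k.*2]|.
  apply: eq_card => alpha; rewrite inE [RHS]inE; case aI: (alpha \in _) => //=.
  have := half_futne_enhne alpha; lia.
by have := card_enhne_futne_leq n m k; rewrite (split_leq (@enhne n)) (split_leq (@futne n)) lt_eq => /addIn.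
Qed.

Import GRing.Theory.
Local Open Scope ring_scope.

(* When [f] and [e] agree up to halving, the antisymmetrized monomial at [a]
   is [~~ odd (e a) - ~~ odd (f a)] times a term depending only on [(e a)./2]. *)
Lemma sum_symmetric_half (R : comNzRingType) (T : finType) (A : {set T})
    (f e : T -> nat) (x y : R) :
  (forall a, a \in A -> (f a)./2 = (e a)./2) ->
  (forall k, #|[set a in A | e a == k.*2]| = #|[set a in A | f a == k.*2]|) ->
  \sum_(a in A) x ^+ f a * y ^+ e a = \sum_(a in A) y ^+ f a * x ^+ e a.
Proof.
move=> half_fe card_fe.
pose w k := x ^+ k.*2.+1 * y ^+ k.*2 - y ^+ k.*2.+1 * x ^+ k.*2.
pose N := (\max_(a in A) maxn (f a) (e a)).+1.
have bound a : a \in A -> (f a < N)%N && (e a < N)%N.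
  by move=> aA; rewrite !ltnS -geq_max (leq_bigmax_cond (F := fun a => maxn (f a) (e a)) _ aA).
(* The corrections enter only through the sizes of the even level sets, which [card_fe] equates. *)
have even_sum (h : T -> nat) : (forall a, a \in A -> (h a < N)%N) ->
    \sum_(a in A) (if odd (h a) then 0 else w (h a)./2) =
    \sum_(k < N) w k *+ #|[set a in A | h a == k.*2]|.
  move=> hN; transitivity (\sum_(a in A) \sum_(k < N) (if h a == k.*2 then w k else 0)).
    apply: eq_bigr => a aA; case: ifP => ha.
      by rewrite big1 // => k _; case: eqP => // E; rewrite E odd_double in ha.
    have hk : ((h a)./2 < N)%N by rewrite (leq_ltn_trans _ (hN a aA)) // leq_half_double; lia.
    rewrite (bigD1 (Ordinal hk)) //= even_halfK ?ha // eqxx big1 ?addr0 // => k kh.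
    case: eqP => // E; case/eqP: kh; apply: val_inj; by rewrite /= E doubleK.
  rewrite exchange_big; apply: eq_bigr => k _ /=; rewrite -big_mkcondr /= -sumr_const.
  by apply: eq_bigl => a; rewrite inE.
(* For equal parities the monomials agree and so do the corrections; for different parities [w] is
   exactly the difference of the monomials. *)
have pointwise a : a \in A ->
    x ^+ f a * y ^+ e a + (if odd (f a) then 0 else w (f a)./2) =
    y ^+ f a * x ^+ e a + (if odd (e a) then 0 else w (e a)./2).
  move=> /half_fe fe.
  rewrite -[in x ^+ f a](odd_double_half (f a)) -[in y ^+ f a](odd_double_half (f a)).
  rewrite -[in y ^+ e a](odd_double_half (e a)) -[in x ^+ e a](odd_double_half (e a)) fe.
  move: (e a)./2 => k; rewrite /w.
  case: (odd (f a)); case: (odd (e a)); rewrite ?add0n ?add1n ?addr0.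
  - exact: mulrC.
  - by rewrite addrC subrK.
  - by rewrite [x ^+ k.*2 * _]mulrC [y ^+ k.*2 * _]mulrC subrKC.
  - by rewrite [x ^+ k.*2 * _]mulrC.
have H : \sum_(a in A) (x ^+ f a * y ^+ e a + (if odd (f a) then 0 else w (f a)./2)) =
         \sum_(a in A) (y ^+ f a * x ^+ e a + (if odd (e a) then 0 else w (e a)./2)).
  exact: eq_bigr.
move: H; rewrite !big_split /= !even_sum; last 2 first.
- by move=> a /bound/andP[].
- by move=> a /bound/andP[].
by under [X in _ + X = _]eq_bigr => k _ do rewrite -card_fe; move/addIr.
Qed.

Theorem theorem14 (n m : nat) :
  let x : {mpoly int[2]} := 'X_(0 : 'I_2) in
  let y : {mpoly int[2]} := 'X_(1 : 'I_2) in
  \sum_(alpha in involutions_with n m) x ^+ futne alpha * y ^+ enhne alpha =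
  \sum_(alpha in involutions_with n m) y ^+ futne alpha * x ^+ enhne alpha.
Proof.
move=> x y; apply: sum_symmetric_half => [alpha _|k].
  exact: half_futne_enhne.
exact: card_enhne_futne_even.
Qed.
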